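(* Let $((G(n))_{n\in\mathbb{N}},(i_{n_1,n_2})_{n_1\mid n_2})$ and $((A(n))_{n\in\mathbb{N}},(j_{n_1,n_2})_{n_1\mid n_2})$ be surjective inverse systems of finite groups ordered by the divisibility relation on $\mathbb{N}$, with transition maps $i_{n_1,n_2}:G(n_2)\to G(n_1)$ and $j_{n_1,n_2}:A(n_2)\to A(n_1)$ for $n_1\mid n_2$. Assume that for each $n\ge1$ there is an injective group homomorphism $r_n:G(n)\to A(n)$ such that $j_{n_1,n_2}\circ r_{n_2}=r_{n_1}\circ i_{n_1,n_2}$ whenever $n_1\mid n_2$, and let $r:G=\varprojlim G(n)\to A=\varprojlim A(n)$ be the resulting injective continuous homomorphism of profinite groups. Let $m$ be a fixed positive integer, let $\mu_m$ be the group of $m$-th roots of unity, and suppose there exists an exact sequence $$1\to G\stackrel{r}{\longrightarrow}A\stackrel{\chi}{\longrightarrow}\mu_m\to1$$ with $\chi$ a continuous homomorphism. Let $g$ be a multiplicative arithmetic function such that $\sum_{n\ge1}|g(n)|/\#G(n)<\infty$. Assume that $(h_n)_{n\in\mathbb{N}}$ is a family of isomorphisms $h_n:A(n)\to\prod_{p^k\Vert n}A(p^k)$, compatible with the transition maps $(j_{n_1,n_2})_{n_1\mid n_2}$, that results in a topological isomorphism $A\cong\prod_pA_p$, where $A_p=\varprojlim A(p^i)$. In addition, let $\chi=\prod_p\chi_p$, where the continuous characters $\chi_p:A_p\to\mu_m$ are trivial except for finitely many primes $p$. For each prime $p$ let $\varphi_{p^k}:A_p\to A(p^k)$ be the projection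 map and let $\nu_{A_p}$ be the normalized Haar measure on $A_p$. Then, for every prime $p$, $$\tilde g_p:=\sum_{k\ge0}g(p^k)\,1_{\ker\varphi_{p^k}}\in L^1(\nu_{A_p}),$$ and $$\sum_{n\ge1}\frac{g(n)}{\#G(n)}=\sum_{i=0}^{m-1}\prod_p\int_{A_p}\tilde g_p\,\chi_p^i\,d\nu_{A_p}.$$
   Context: An inverse system is surjective if all its transition maps are surjective. $p^k\Vert n$ means $p^k\mid n$ and $p^{k+1}\nmid n$, with $p$ a prime dividing $n$; products over $p$ are over all primes. The identity $\chi=\prod_p\chi_p$ is understood via the isomorphism $A\cong\prod_pA_p$, i.e. $\chi(\alpha)=\prod_p\chi_p(\alpha_p)$ where $\alpha_p\in A_p$ are the components of $\alpha$. $1_S$ denotes the characteristic function of a set $S$. $\mu_m$ is regarded as the group of complex $m$-th roots of unity. The normalized Haar measure on a profinite group is the Haar measure of total mass $1$; $L^1(\nu)$ is the space of $\nu$-integrable functions (series of functions being considered almost everywhere). An arithmetic function is a complex-valued function on the positive integers; it is multiplicative if $g(1)=1$ and $g(mn)=g(m)g(n)$ for coprime $m,n$. *)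

(* Defs.v *)
From HB Require Import structures.
From mathcomp Require Import all_boot all_order all_algebra all_fingroup.
From mathcomp Require Import all_classical all_reals all_analysis.
From mathcomp Require Import complex.

Set Implicit Arguments.
Unset Strict Implicit.
Unset Printing Implicit Defensive.

Import Order.TTheory GRing.Theory Num.Theory.
Import numFieldNormedType.Exports.

Local Open Scope classical_set_scope.
Local Open Scope ring_scope.

(* The transition maps are total families of functions; [trans i j] carries
   information only when [le i j], and is unconstrained otherwise. *)
Record invsystem (I : Type) (le : rel I) := InvSystem {
  obj :> I -> finGroupType;
  trans : forall i j : I, obj j -> obj i;
  transM : forall i j, le i j ->
    {morph @trans i j : x y / (x * y)%g >-> (x * y)%g};
  trans_id : forall i (x : obj i), le i i -> @trans i i x = x;
  trans_trans : forall i j k, le i j -> le j k ->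
    forall x : obj k, @trans i j (@trans j k x) = @trans i k x }.
Arguments trans {I le} S i j x : rename.

Definition surjective_system (I : Type) (le : rel I) (S : invsystem le) :
    Prop :=
  forall i j, le i j -> forall y : S i, exists x : S j, trans S i j x = y.

Section InverseLimit.
Context {I : Type} {le : rel I}.
Implicit Type S : invsystem le.

Definition threads S : set (prod_topology (fun i => discrete_topology (S i))) :=
  [set x | forall i j, le i j -> trans S i j (x j) = x i].

Arguments threads S : clear implicits.

Definition invlim S : Type := set_type (threads S).

HB.instance Definition _ S := Topological.on (invlim S).

Definition invlim_proj S (i : I) (x : invlim S) : S i :=
  (set_val x : forall i, S i) i.
Arguments invlim_proj {S} i x.

Lemma invlim_projP S (x : invlim S) i j : le i j ->
  trans S i j (invlim_proj j x) = invlim_proj i x.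
Proof. by move=> ij; have := set_valP x; apply. Qed.

Definition mk_invlim S (x : forall i, S i)
    (xP : forall i j, le i j -> trans S i j (x j) = x i) : invlim S :=
  exist (fun y => y \in threads S) x (mem_set (xP : threads S x)).

Lemma invlim_proj_mk S x xP i : invlim_proj i (@mk_invlim S x xP) = x i.
Proof. by []. Qed.

Lemma invlim_proj_inj S (x y : invlim S) :
  (forall i, invlim_proj i x = invlim_proj i y) -> x = y.
Proof. by move=> xy; apply/val_inj; apply: functional_extensionality_dep. Qed.

Lemma trans1 S i j : le i j -> trans S i j 1%g = 1%g.
Proof.
move=> ij; apply: (mulgI (trans S i j 1%g)).
by rewrite -transM// !mulg1.
Qed.

Lemma transV S i j x : le i j -> trans S i j x^-1%g = (trans S i j x)^-1%g.
Proof.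
move=> ij; apply: (mulgI (trans S i j x)).
by rewrite -transM// !mulgV trans1.
Qed.

Program Definition invlim_one S : invlim S := @mk_invlim S (fun i => 1%g) _.
Next Obligation. by move=> S i j; apply: trans1. Qed.

Program Definition invlim_inv S (x : invlim S) : invlim S :=
  @mk_invlim S (fun i => (invlim_proj i x)^-1%g) _.
Next Obligation. by move=> S x i j ij /=; rewrite transV// invlim_projP. Qed.

Program Definition invlim_mul S (x y : invlim S) : invlim S :=
  @mk_invlim S (fun i => invlim_proj i x * invlim_proj i y)%g _.
Next Obligation. by move=> S x y i j ij /=; rewrite transM// !invlim_projP. Qed.

Lemma invlim_mulgA S : associative (@invlim_mul S).
Proof. by move=> x y z; apply: invlim_proj_inj => i; apply: mulgA. Qed.
Lemma invlim_mul1g S : left_id (invlim_one S) (@invlim_mul S).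
Proof. by move=> x; apply: invlim_proj_inj => i; apply: mul1g. Qed.
Lemma invlim_mulg1 S : right_id (invlim_one S) (@invlim_mul S).
Proof. by move=> x; apply: invlim_proj_inj => i; apply: mulg1. Qed.
Lemma invlim_mulVg S :
  left_inverse (invlim_one S) (@invlim_inv S) (@invlim_mul S).
Proof. by move=> x; apply: invlim_proj_inj => i; apply: mulVg. Qed.
Lemma invlim_mulgV S :
  right_inverse (invlim_one S) (@invlim_inv S) (@invlim_mul S).
Proof. by move=> x; apply: invlim_proj_inj => i; apply: mulgV. Qed.

HB.instance Definition _ S := isGroup.Build (invlim S)
  (@invlim_mulgA S) (@invlim_mul1g S) (@invlim_mulg1 S)
  (@invlim_mulVg S) (@invlim_mulgV S).

HB.instance Definition _ S := isPointed.Build (invlim S) (invlim_one S).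

End InverseLimit.
Arguments invlim_proj {I le S} i x.

Record sysmorphism (I : Type) (le : rel I) (S T : invsystem le) := SysMorphism {
  smap :> forall i, S i -> T i;
  smapM : forall i, {morph @smap i : x y / (x * y)%g >-> (x * y)%g};
  smap_trans : forall i j, le i j ->
    forall x : S j, trans T i j (@smap j x) = @smap i (trans S i j x) }.

Program Definition lim_map (I : Type) (le : rel I) (S T : invsystem le)
    (r : sysmorphism S T) (x : invlim S) : invlim T :=
  @mk_invlim I le T (fun i => r i (invlim_proj i x)) _.
Next Obligation.
by move=> I le S T r x i j ij /=; rewrite smap_trans// invlim_projP.
Qed.

(* [0] has to be excluded from the index set: it is the top element for
   divisibility, so a limit over all of [nat] would collapse to its value. *)
Notation posint := {n : nat | (0 < n)%N}.
Definition dvd_pos : rel posint := fun a b => (val a %| val b)%N.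
Definition possucc (n : nat) : posint :=
  exist (fun n => 0 < n)%N n.+1 (ltn0Sn n).

Notation primeint := {p : nat | prime p}.

Lemma ppow_gt0 (p : primeint) k : (0 < val p ^ k)%N.
Proof. by rewrite expn_gt0 prime_gt0//; case: p. Qed.

Definition ppow (p : primeint) (k : nat) : posint :=
  exist (fun n => 0 < n)%N (val p ^ k)%N (ppow_gt0 p k).

Lemma ppow_dvd p k l : (k <= l)%N -> dvd_pos (ppow p k) (ppow p l).
Proof. exact: dvdn_exp2l. Qed.

Lemma ppow_dvdP (p q : primeint) k l : val p = val q -> (k <= l)%N ->
  dvd_pos (ppow p k) (ppow q l).
Proof. by rewrite /dvd_pos /= => ->; apply: dvdn_exp2l. Qed.

(* The system [A(p^0) <- A(p) <- A(p^2) <- ...], with limit [A_p]. *)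
Program Definition primary (A : invsystem dvd_pos) (p : primeint) :
    invsystem leq :=
  @InvSystem nat leq (fun k => A (ppow p k))
    (fun k l => trans A (ppow p k) (ppow p l)) _ _ _.
Next Obligation. by move=> A p k l kl; apply/transM/ppow_dvd. Qed.
Next Obligation. by move=> A p k x _; apply/trans_id/ppow_dvd. Qed.
Next Obligation.
by move=> A p i j k ij jk x; apply: trans_trans; apply: ppow_dvd.
Qed.

Lemma prime_of_subproof n (q : seq_sub (primes n)) : prime (ssval q).
Proof. by have := ssvalP q; rewrite mem_primes => /andP[]. Qed.

Definition prime_of n (q : seq_sub (primes n)) : primeint :=
  exist (fun p => prime p) (ssval q) (prime_of_subproof q).

(* The level [p^k] with [p^k || n], for a prime [p] dividing [n]. *)
Definition ppart n (q : seq_sub (primes n)) : posint :=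
  ppow (prime_of q) (logn (ssval q) n).

Record prime_decomposition (A : invsystem dvd_pos) := PrimeDecomposition {
  pd_map :> forall n : posint,
    A n -> {dffun forall q : seq_sub (primes (val n)), A (ppart q)};
  pd_mapM : forall n, {morph @pd_map n : x y / (x * y)%g >-> (x * y)%g};
  pd_map_bij : forall n, bijective (@pd_map n);
  pd_map_trans : forall n1 n2, dvd_pos n1 n2 -> forall (x : A n2)
      (q1 : seq_sub (primes (val n1))) (q2 : seq_sub (primes (val n2))),
    ssval q1 = ssval q2 ->
    @pd_map n1 (trans A n1 n2 x) q1 =
    trans A (ppart q1) (ppart q2) (@pd_map n2 x q2) }.

Lemma mem_primes_ppow (p : primeint) k : val p \in primes (val (ppow p k.+1)).
Proof. by rewrite /= primesX// primes_prime ?inE//; case: p. Qed.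

Definition pidx (p : primeint) k : seq_sub (primes (val (ppow p k.+1))) :=
  SeqSub (mem_primes_ppow p k).

Lemma ppart_pidx p k l : (k <= l.+1)%N -> dvd_pos (ppow p k) (ppart (pidx p l)).
Proof. by move=> kl; apply: ppow_dvdP => //=; rewrite pfactorK//; case: p. Qed.

(* The component [alpha_p] in [A_p] of [alpha] under the isomorphism of [A]
   with the product of the [A_p] induced by [h]. Its [k]-th coordinate is read
   off one level higher, at [p^(k+1)], because [h] has no [p]-coordinate at the
   level [p^0]; for [k >= 1] it is also the [p]-coordinate of
   [h (ppow p k) (invlim_proj (ppow p k) alpha)], by [componentE]. *)
Program Definition component (A : invsystem dvd_pos)
    (h : prime_decomposition A) (p : primeint) (alpha : invlim A) :
    invlim (primary A p) :=
  @mk_invlim nat leq (primary A p)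
    (fun k => trans A (ppow p k) (ppart (pidx p k))
      (h (ppow p k.+1) (invlim_proj (ppow p k.+1) alpha) (pidx p k))) _.
Next Obligation.
move=> A h p alpha k l kl /=.
have kl1 : dvd_pos (ppow p k.+1) (ppow p l.+1) by apply: ppow_dvd.
rewrite -(invlim_projP alpha kl1) (pd_map_trans h kl1 _ (q2 := pidx p l))//.
have p1 n : logn (val p) (val p ^ n) = n by rewrite pfactorK//; exact: (valP p).
have kp : dvd_pos (ppow p k) (ppart (pidx p k)) by apply: ppart_pidx.
have lp : dvd_pos (ppow p l) (ppart (pidx p l)) by apply: ppart_pidx.
have kl0 : dvd_pos (ppow p k) (ppow p l) by apply: ppow_dvd.
have kpl : dvd_pos (ppart (pidx p k)) (ppart (pidx p l)).
  by apply: ppow_dvdP => //=; rewrite !p1.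
by rewrite (trans_trans kl0 lp) (trans_trans kp kpl).
Qed.

Lemma componentE (A : invsystem dvd_pos) (h : prime_decomposition A)
    (p : primeint) (alpha : invlim A) (k : nat) :
  invlim_proj k.+1 (component h p alpha) =
  trans A (ppow p k.+1) (ppart (pidx p k))
    (h (ppow p k.+1) (invlim_proj (ppow p k.+1) alpha) (pidx p k)).
Proof.
rewrite invlim_proj_mk.
have p1 n : logn (val p) (val p ^ n) = n by rewrite pfactorK//; exact: (valP p).
have k12 : dvd_pos (ppow p k.+1) (ppow p k.+2) by apply: ppow_dvd.
rewrite -(invlim_projP alpha k12) (pd_map_trans h k12 _ (q2 := pidx p k.+1))//.
rewrite trans_trans//; first by apply: ppart_pidx.
by apply: ppow_dvdP => //=; rewrite !p1.
Qed.

Section Analysis.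
Variable R : realType.

(* [R[i]^o] is [R[i]] with its norm topology. *)
Record is_mu_character (I : Type) (le : rel I) (S : invsystem le) (m : nat)
    (chi : invlim S -> R[i]) : Prop := {
  mu_charM : forall x y, chi (x * y)%g = chi x * chi y;
  mu_charX : forall x, chi x ^+ m = 1;
  mu_char_continuous : continuous (chi : invlim S -> R[i]^o) }.

(* Exactness of [1 -> G -> A -> mu_m -> 1]. *)
Record exact_sequence (I : Type) (le : rel I) (G A : invsystem le) (m : nat)
    (r : invlim G -> invlim A) (chi : invlim A -> R[i]) : Prop := {
  exact_left : injective r;
  exact_middle : range r = [set a | chi a = 1];
  exact_right : range chi = [set z | z ^+ m = 1] }.

Record multiplicative_fun (g : nat -> R[i]) : Prop := {
  multiplicative1 : g 1%N = 1;
  multiplicativeM : forall a b : nat, (0 < a)%N -> (0 < b)%N -> coprime a b ->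
    g (a * b)%N = g a * g b }.

(* [invlim S] with its Borel sigma-algebra. *)
Definition borel (I : Type) (le : rel I) (S : invsystem le) :=
  g_sigma_algebraType (@open (invlim S)).

(* The normalized Haar measure: the total mass [1] is part of [probability].
   On the compact metrizable groups considered here every finite Borel measure
   is regular, so that translation invariance determines it. *)
Definition is_haar (I : Type) (le : rel I) (S : invsystem le)
    (nu : probability (borel S) R) : Prop :=
  forall (a : invlim S) (B : set (borel S)), measurable B ->
    nu [set (a * x)%g | x in (B : set (invlim S))] = nu B.

Section Integral.
Context d (T : measurableType d) (mu : {measure set T -> \bar R}).

Definition complex_integrable (f : T -> R[i]) : Prop :=
  mu.-integrable setT (fun x => (complex.Re (f x))%:E) /\
  mu.-integrable setT (fun x => (complex.Im (f x))%:E).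

Definition complex_integral (f : T -> R[i]) : R[i] :=
  Complex (Rintegral mu setT (fun x => complex.Re (f x)))
          (Rintegral mu setT (fun x => complex.Im (f x))).

End Integral.

Section LocalFactor.
Variables (A : invsystem dvd_pos) (g : nat -> R[i]) (p : primeint).

Definition ker_proj (k : nat) : set (invlim (primary A p)) :=
  [set x | invlim_proj k x = 1%g].

Definition gtilde_partial (x : invlim (primary A p)) (N : nat) : R[i]^o :=
  \sum_(0 <= k < N) g (val p ^ k)%N * \1_(ker_proj k) x.

(* The pointwise sum; its value is unspecified where the series diverges. *)
Definition gtilde (x : invlim (primary A p)) : R[i] := limn (gtilde_partial x).

End LocalFactor.
End Analysis.

(* Main.v *)
Require Import Defs.
From HB Require Import structures.
From mathcomp Require Import all_boot all_order all_algebra all_fingroup.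
From mathcomp Require Import all_classical all_reals all_analysis.
From mathcomp Require Import complex.
From mathcomp Require Import cyclic separable cyclotomic measurable_realfun.
From mathcomp Require Import ring lra.

(** The idea is to detect [G] inside [A] by the characters [chi ^ i].

    Let [K_n] be the kernel of [A -> A(n)]. The group [mu_m] is cyclic and
    [A / G] is isomorphic to it through [chi], so the index of [G(n)] in [A(n)]
    equals the number of [i < m] for which [chi ^ i] is trivial on [K_n]
    ([card_level_index]). Hence [1 / #G(n)] is the sum over [i < m] of
    [w_i(n)], where [w_i(n)] is [1 / #A(n)] if [chi ^ i] is trivial on [K_n]
    and 0 otherwise; this is the integral of [chi ^ i] over [K_n].

    Under the decomposition of [A] into primary components, [K_n] is the product
    of the kernels of [A_p -> A(p^k)], where [p^k] is the exact power of [p] in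
    [n], and [#A(n)] is the product of the [#A(p^k)]. So [w_i(n)] is a product
    of local terms over all primes [p], each the integral of [chi_p ^ i] over
    the local kernel ([trivial_on_kernel_local], [card_level_prod]). At a prime
    where [chi_p ^ i] is nontrivial the local term at [k = 0] is 0 and not 1,
    but there are only finitely many such primes, and the series of
    [g(n) w_i(n)], dominated by that of [|g(n)| / #G(n)], still has an Euler
    product ([euler_product]).

    The local factor at [p] is the sum over [k] of [g(p^k)] times the integral
    of [chi_p ^ i] over the kernel at level [k]. Since
    [sum_k |g(p^k)| / #A(p^k)] is finite and the kernel at level [k] has Haar
    measure [1 / #A(p^k)], dominated convergence gives both the integrability of
    [gtilde] and the equality of this sum with the integral of
    [gtilde * chi_p ^ i] ([local_factor]). *)

Set Implicit Arguments.
Unset Strict Implicit.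
Unset Printing Implicit Defensive.

Import Order.TTheory GRing.Theory Num.Theory.
Import numFieldNormedType.Exports.

Local Open Scope classical_set_scope.
Local Open Scope ring_scope.

(** * Complex limits and roots of unity *)

Section ComplexLimits.
Variable R : realType.
Implicit Types (z w : R[i]) (u : nat -> R[i]^o).

(** The norm of [R[i]] takes its values in [R[i]]; estimates and sums of
    absolute values need it as an element of the ordered complete field [R]. *)
Definition cnorm z : R := complex.Re `|z|.

Lemma cnormE z : `|z| = (cnorm z)%:C%C.
Proof. by rewrite /cnorm normc_def. Qed.

Lemma cnorm_ge0 z : 0 <= cnorm z.
Proof. by rewrite -(lecR 0) -cnormE; exact: normr_ge0. Qed.

Lemma cnorm0 : cnorm 0 = 0.
Proof. by rewrite /cnorm normr0. Qed.

Lemma cnormM z w : cnorm (z * w) = cnorm z * cnorm w.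
Proof. by apply: complexI; rewrite rmorphM -!cnormE normrM. Qed.

Lemma cnormN z : cnorm (- z) = cnorm z.
Proof. by rewrite /cnorm normrN. Qed.

Lemma cnorm_real (x : R) : 0 <= x -> cnorm x%:C%C = x.
Proof. by move=> x0; rewrite /cnorm ger0_norm ?lecR. Qed.

Lemma cnormD z w : cnorm (z + w) <= cnorm z + cnorm w.
Proof. by rewrite -lecR rmorphD -!cnormE ler_normD. Qed.

Lemma cnorm_sum (I : Type) (s : seq I) (P : pred I) (F : I -> R[i]) :
  cnorm (\sum_(i <- s | P i) F i) <= \sum_(i <- s | P i) cnorm (F i).
Proof.
elim/big_ind2: _ => [|z a w b za wb|//]; first by rewrite cnorm0.
by apply: le_trans (cnormD _ _) _; apply: lerD.
Qed.

Lemma norm_Re_le z : `|complex.Re z| <= cnorm z.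
Proof. by rewrite -lecR -cnormE normc_ge_Re. Qed.

Lemma norm_Im_le z : `|complex.Im z| <= cnorm z.
Proof.
rewrite /cnorm normc_def/=; case: z => a b /=.
by rewrite -sqrtr_sqr ler_wsqrtr// lerDr sqr_ge0.
Qed.

Lemma cnorm_le_ReIm z : cnorm z <= `|complex.Re z| + `|complex.Im z|.
Proof.
case: z => a b; rewrite /cnorm normc_def/=.
rewrite -(ger0_norm (addr_ge0 (normr_ge0 a) (normr_ge0 b))) -[leRHS]sqrtr_sqr.
rewrite ler_wsqrtr// sqrrD !real_normK ?num_real//.
by rewrite addrAC lerDl mulrn_wge0// mulr_ge0.
Qed.

Lemma cvg_complexP u (l : R[i]) :
  u @ \oo --> (l : R[i]^o) <->
  (fun n => cnorm (l - u n)) @ \oo --> (0 : R).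
Proof.
split=> ul.
  apply/cvgrPdist_lt => e e0; move/cvgrPdist_lt: ul => /(_ e%:C%C).
  rewrite ltcR => /(_ e0); apply: filterS => n.
  by rewrite cnormE ltcR sub0r normrN ger0_norm ?cnorm_ge0.
apply/cvgrPdist_lt => -[e e'] e0.
have [e'0 {}e0] : e' = 0 /\ 0 < e.
  by move: e0; rewrite ltcE/= => /andP[/eqP -> ->].
move/cvgrPdist_lt: ul => /(_ e e0); apply: filterS => n.
rewrite cnormE sub0r normrN ger0_norm ?cnorm_ge0// => h.
by rewrite e'0 ltcR.
Qed.

Lemma cvg_ReImP u (l : R[i]) :
  u @ \oo --> (l : R[i]^o) <->
  (fun n => complex.Re (u n)) @ \oo --> complex.Re l /\
  (fun n => complex.Im (u n)) @ \oo --> complex.Im l.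
Proof.
have dRe z w : complex.Re (z - w) = complex.Re z - complex.Re w.
  by case: z w => [? ?] [? ?].
have dIm z w : complex.Im (z - w) = complex.Im z - complex.Im w.
  by case: z w => [? ?] [? ?].
split=> [/cvg_complexP /cvgrPdist_lt ul|[ur ui]].
  split; apply/cvgrPdist_lt => e e0; apply: filterS (ul e e0) => n.
    rewrite sub0r normrN ger0_norm ?cnorm_ge0// -dRe.
    exact: le_lt_trans (norm_Re_le _).
  rewrite sub0r normrN ger0_norm ?cnorm_ge0// -dIm.
  exact: le_lt_trans (norm_Im_le _).
apply/cvg_complexP; apply: (@squeeze_cvgr _ _ _ _ (fun=> 0) (fun n =>
    `|complex.Re l - complex.Re (u n)| + `|complex.Im l - complex.Im (u n)|)).
- apply: nearW => n; rewrite cnorm_ge0/= -dRe -dIm; exact: cnorm_le_ReIm.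
- exact: cvg_cst.
- rewrite -(addr0 (0 : R)); apply: cvgD.
    rewrite -(normr0 R) -(subrr (complex.Re l)).
    by apply: cvg_norm; apply: cvgB => //; exact: cvg_cst.
  rewrite -(normr0 R) -(subrr (complex.Im l)).
  by apply: cvg_norm; apply: cvgB => //; exact: cvg_cst.
Qed.

Lemma Re_sum (I : Type) (s : seq I) (F : I -> R[i]) :
  complex.Re (\sum_(i <- s) F i) = \sum_(i <- s) complex.Re (F i).
Proof.
by apply: (big_morph (fun z : R[i] => complex.Re z)) => // -[? ?] [? ?].
Qed.

Lemma Im_sum (I : Type) (s : seq I) (F : I -> R[i]) :
  complex.Im (\sum_(i <- s) F i) = \sum_(i <- s) complex.Im (F i).
Proof.
by apply: (big_morph (fun z : R[i] => complex.Im z)) => // -[? ?] [? ?].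
Qed.

Lemma bounded_series_cvg (a : nat -> R) (C : R) : (forall n, 0 <= a n) ->
  (forall N, \sum_(0 <= n < N) a n <= C) -> cvgn (series a).
Proof.
move=> a0 aC; apply: nondecreasing_is_cvgn.
  exact: nondecreasing_series.
by exists C => _ [N _ <-]; apply: aC.
Qed.

(** The completeness of [R] is used on real and imaginary parts, whose series
    are dominated by that of the norms. *)
Lemma abs_series_cvg (c : nat -> R[i]) (C : R) :
  (forall N, \sum_(0 <= n < N) cnorm (c n) <= C) ->
  exists l : R[i], ((fun N => \sum_(0 <= n < N) c n) : nat -> R[i]^o) @ \oo
    --> (l : R[i]^o).
Proof.
move=> cC.
have cv (f : R[i] -> R) : (forall z, `|f z| <= cnorm z) ->
    cvgn (series (fun n => f (c n))).
  move=> fz; apply: normed_cvg; apply: (@bounded_series_cvg _ C) => [n|N].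
    exact: normr_ge0.
  by apply: le_trans (cC N); apply: ler_sum => n _; apply: fz.
have /cvg_ex[a ha] := cv _ norm_Re_le; have /cvg_ex[b hb] := cv _ norm_Im_le.
exists (Complex a b); apply/cvg_ReImP; split => /=.
  by under eq_fun do rewrite Re_sum.
by under eq_fun do rewrite Im_sum.
Qed.

End ComplexLimits.

Section RootsOfUnity.
Variable R : realType.

(** In characteristic zero ['X^m - 1] is separable, so it has [m] distinct roots
    in an algebraically closed field, and these form a cyclic group. *)
Lemma complex_primitive_root (m : nat) : (0 < m)%N ->
  exists z : R[i], m.-primitive_root z.
Proof.
move=> m0; have [rs rsE] := closed_field_poly_normal ('X^m - 1 : {poly R[i]}).
move: rsE; rewrite lead_coefDl ?lead_coefXn ?scale1r; last first.
  by rewrite size_polyXn size_polyN size_poly1.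
move=> rsE.
have urs : uniq rs.
  by rewrite -separable_prod_XsubC -rsE separable_Xn_sub_1// pnatr_eq0 -lt0n.
have srs : size rs = m.
  have := size_prod_XsubC rs id; rewrite -rsE size_polyDl ?size_polyXn.
    by move=> [->].
  by rewrite size_polyN size_poly1.
have ars : all m.-unity_root rs.
  by apply/allP => z; rewrite -root_prod_XsubC -rsE.
have /hasP[z _ zm] := has_prim_root m0 ars urs (eq_leq (esym srs)).
by exists z.
Qed.

Lemma unity_roots_enum (m : nat) : (0 < m)%N ->
  exists rs : seq R[i], uniq rs /\ forall w, (w \in rs) = (w ^+ m == 1).
Proof.
move=> m0; have [z zm] := complex_primitive_root m0.
exists [seq z ^+ j | j <- iota 0 m]; split.
  rewrite map_inj_in_uniq ?iota_uniq// => j k; rewrite !mem_iota/= => jm km.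
  by move/eqP; rewrite (eq_prim_root_expr zm) !modn_small// => /eqP.
move=> w; apply/mapP/eqP => [[j _ ->]|/(prim_rootP zm)[j ->]].
  by rewrite exprAC (prim_expr_order zm) expr1n.
by exists (val j) => //; rewrite mem_iota/=; exact: ltn_ord.
Qed.

Lemma cnorm_unity_root (m : nat) (w : R[i]) : (0 < m)%N -> w ^+ m = 1 ->
  cnorm w = 1.
Proof.
move=> m0 wm; apply/eqP; rewrite -(pexpr_eq1 m0) ?cnorm_ge0//.
have := congr1 (fun z : R[i] => complex.Re z) (normrX m w).
by rewrite wm normr1 cnormE -rmorphXn/= => <-.
Qed.

End RootsOfUnity.

(** * Euler products *)

Section PrimesBelow.

(** Products over primes are handled along duplicate-free sequences of primes,
    which allow induction on the set of primes. *)
Definition primes_below (N : nat) : seq primeint := pmap insub (iota 0 N).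

Lemma mem_primes_below (p : primeint) N :
  (p \in primes_below N) = (val p < N)%N.
Proof. by rewrite mem_pmap_sub mem_iota. Qed.

Lemma primes_below_uniq N : uniq (primes_below N).
Proof. by apply: pmap_sub_uniq; apply: iota_uniq. Qed.

Lemma fsbig_primes_below (R : comNzRingType) (F : primeint -> R) N :
  \big[*%R/1]_(p \in [set p : primeint | (val p < N)%N]) F p =
  \prod_(p <- primes_below N) F p.
Proof.
rewrite [RHS]fsbig_seq ?primes_below_uniq//.
rewrite (_ : [set` primes_below N] = [set p : primeint | (val p < N)%N])//.
by apply/seteqP; split=> p /=; rewrite mem_primes_below.
Qed.

End PrimesBelow.

Section SupportedNumbers.

(** The numbers all of whose prime divisors lie in [ps], each to a power below
    [K]. Both truncations keep the expansion of the product of local sums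
    finite; unique factorization says that the enumeration has no repetition. *)
Fixpoint supported_numbers (ps : seq primeint) (K : nat) : seq nat :=
  if ps is p :: qs then
    [seq (n * val p ^ k)%N | n <- supported_numbers qs K, k <- iota 0 K]
  else [:: 1%N].

Lemma supported_numbers_gt0 ps K n :
  n \in supported_numbers ps K -> (0 < n)%N.
Proof.
elim: ps n => [|p ps IH] n /=; first by rewrite inE => /eqP ->.
case/allpairsP => -[n' k] /= [/IH n0 _ ->].
by rewrite muln_gt0 n0 ppow_gt0.
Qed.

Lemma logn_ppow (p q : primeint) k :
  logn (val p) (val q ^ k) = if p == q then k else 0%N.
Proof.
rewrite lognX logn_prime ?(valP q)//.
by rewrite -val_eqE; case: eqP => _; rewrite ?muln1 ?muln0.
Qed.

Lemma logn_supported ps K n (p : primeint) :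
  n \in supported_numbers ps K -> p \notin ps -> logn (val p) n = 0%N.
Proof.
elim: ps n => [|q ps IH] n /=; first by rewrite inE => /eqP ->; rewrite logn1.
case/allpairsP => -[n' k] /= [n'_in _ ->]; rewrite inE negb_or => /andP[pq pps].
rewrite lognM ?ppow_gt0 ?(supported_numbers_gt0 n'_in)// (IH n')//.
by rewrite logn_ppow (negbTE pq).
Qed.

Lemma mem_supported_numbers ps K n : uniq ps -> (0 < K)%N -> (0 < n)%N ->
  (forall p : primeint, (logn (val p) n < K)%N) ->
  (forall p : primeint, p \notin ps -> logn (val p) n = 0%N) ->
  n \in supported_numbers ps K.
Proof.
move=> + K0; elim: ps n => [|p ps IH] n /= ups n0 nK nps.
  rewrite inE; apply/eqP; apply: eqn_from_log => // q.
  rewrite logn1; case: (boolP (prime q)) => qp; first exact: (nps (exist _ q qp)).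
  by rewrite lognE (negbTE qp).
move: ups => /andP[pps ups].
have [m pm nE] := pfactor_coprime (valP p) n0.
have m0 : (0 < m)%N by move: n0; rewrite nE muln_gt0 => /andP[].
have lm (q : primeint) :
    logn (val q) n = (logn (val q) m + if q == p then logn (val p) n else 0)%N.
  by rewrite {1}nE lognM ?ppow_gt0// logn_ppow.
apply/allpairsP; exists (m, logn (val p) n); split => //=.
- apply: IH => // q; first by apply: leq_ltn_trans (nK q); rewrite lm leq_addr.
  have [-> _|qp qps] := eqVneq q p; first by rewrite logn_coprime.
  have := nps q; rewrite inE negb_or qp qps => /(_ isT) /eqP.
  by rewrite lm addn_eq0 => /andP[/eqP].
- by rewrite mem_iota/= add0n; exact: nK.
Qed.

Lemma supported_numbers_uniq ps K : uniq ps -> uniq (supported_numbers ps K).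
Proof.
elim: ps => //= p ps IH /andP[pps /IH us].
apply: allpairs_uniq => //; first exact: iota_uniq.
move=> _ _ /allpairsP[[n k] /= [n_in _ ->]] /allpairsP[[n' k'] /= [n'_in _ ->]] /=.
move=> e.
have lp (x : nat) l : x \in supported_numbers ps K ->
    logn (val p) (x * val p ^ l)%N = l.
  move=> x_in; rewrite lognM ?ppow_gt0 ?(supported_numbers_gt0 x_in)//.
  by rewrite (logn_supported x_in pps) logn_ppow eqxx.
have kk' : k = k' by rewrite -(lp n k n_in) e lp.
move/eqP: e; rewrite kk' eqn_pmul2r ?ppow_gt0// => /eqP ->.
by [].
Qed.

(** Expanding the product picks one exponent for each prime, that is, one number
    supported on [ps]. *)
Lemma prod_sum_supported (R : comNzRingType) (b : primeint -> nat -> R) ps K :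
  uniq ps ->
  \prod_(p <- ps) \sum_(0 <= k < K) b p k =
  \sum_(n <- supported_numbers ps K) \prod_(p <- ps) b p (logn (val p) n).
Proof.
elim: ps => [|p ps IH]; first by rewrite !big_nil big_seq1 big_nil.
move=> /= /andP[pps ups]; rewrite big_cons IH// mulrC.
rewrite big_allpairs_dep/= mulr_suml big_seq [RHS]big_seq; apply: eq_bigr => n n_in.
rewrite mulr_sumr /index_iota subn0; apply: eq_bigr => k _.
rewrite big_cons mulrC; congr (_ * _).
  rewrite lognM ?ppow_gt0 ?(supported_numbers_gt0 n_in)//.
  by rewrite (logn_supported n_in pps) logn_ppow eqxx.
rewrite big_seq [RHS]big_seq; apply: eq_bigr => q q_in.
rewrite lognM ?ppow_gt0 ?(supported_numbers_gt0 n_in)// logn_ppow.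
case: eqP q_in => [->|_]; first by rewrite (negbTE pps).
by rewrite addn0.
Qed.

End SupportedNumbers.

Section EulerProduct.
Variable R : realType.
Implicit Types (u : nat -> R) (c : nat -> R[i]).

Lemma sum_uniq_le u (s : seq nat) (M L : nat) : (forall n, 0 <= u n) ->
  uniq s -> {subset s <= index_iota M L} ->
  \sum_(n <- s) u n <= \sum_(M <= n < L) u n.
Proof.
move=> u0 us sML.
have ps : perm_eq s [seq n <- index_iota M L | n \in s].
  apply: uniq_perm => //; first by rewrite filter_uniq// iota_uniq.
  move=> n; rewrite mem_filter; case: (boolP (n \in s)) => //= /sML ->.
  by [].
by rewrite (perm_big _ ps) big_filter big_mkcond/=; apply: ler_sum => n _; case: ifP.
Qed.

(** Bounds the part of a sum over supported numbers that lies beyond [M] by a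
    tail of the dominating series. *)
Lemma sum_uniq_tail u (s : seq nat) (M : nat) (e : R) : (forall n, 0 <= u n) ->
  (forall N, \sum_(M <= n < N) u n.+1 <= e) ->
  uniq s -> (forall n, n \in s -> (M < n)%N) ->
  \sum_(n <- s) u n <= e.
Proof.
move=> u0 ue us sM.
apply: (@le_trans _ _ (\sum_(M.+1 <= n < (\max_(n <- s) n).+1) u n)).
  apply: sum_uniq_le => // n n_in; rewrite mem_index_iota sM//= ltnS.
  by apply: leq_bigmax_seq.
by rewrite big_add1.
Qed.

(** An Euler product in which finitely many primes [p < N0] may have
    [b p 0 <> 1], so that [c] need not be multiplicative; the factorization of
    [c] is only required along all primes below some [N >= N0]. Absolute
    convergence makes this harmless: for [N] and [K] large, the numbers
    supported on the primes below [N] with exponents below [K] include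
    [1, ..., M], so that the truncated product and the partial sum up to [M]
    differ by at most a tail of [u]. *)
Lemma euler_product c u (b : primeint -> nat -> R[i]) (B : primeint -> R[i])
    (C : R) (N0 : nat) :
  (forall n, (0 < n)%N -> cnorm (c n) <= u n) -> (forall n, 0 <= u n) ->
  (forall N, \sum_(0 <= n < N) u n.+1 <= C) ->
  (forall p, ((fun K => \sum_(0 <= k < K) b p k) : nat -> R[i]^o) @ \oo -->
     (B p : R[i]^o)) ->
  (forall N n, (N0 <= N)%N -> (0 < n)%N ->
     (forall p : primeint, p \notin primes_below N -> logn (val p) n = 0%N) ->
     c n = \prod_(p <- primes_below N) b p (logn (val p) n)) ->
  exists L : R[i],
    ((fun N => \sum_(0 <= n < N) c n.+1) : nat -> R[i]^o) @ \oo --> (L : R[i]^o)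
    /\ ((fun N => \prod_(p <- primes_below N) B p) : nat -> R[i]^o) @ \oo
         --> (L : R[i]^o).
Proof.
move=> cu u0 uC bB cb.
have [L cL] : exists L : R[i],
    ((fun N => \sum_(0 <= n < N) c n.+1) : nat -> R[i]^o) @ \oo --> (L : R[i]^o).
  apply: (@abs_series_cvg _ _ C) => N.
  by apply: le_trans (uC N); apply: ler_sum => n _; exact: cu.
exists L; split => //; apply/cvg_complexP/cvgrPdist_lt => e e0.
have e4 : 0 < e / 4%:R by rewrite divr_gt0.
have /cvg_ex[U uU] : cvgn (series (fun n => u n.+1)).
  by apply: (@bounded_series_cvg _ _ C).
have ule N : \sum_(0 <= n < N) u n.+1 <= U.
  rewrite -(cvg_lim _ uU)//.
  apply: (@nondecreasing_cvgn_le _ (series (fun n => u n.+1))).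
    by apply: nondecreasing_series.
  by apply/cvg_ex; exists U.
(* [M] cuts the series where the tail of [u] drops below a quarter of [e]. *)
have [M _ /(_ M (leqnn M)) /= uM] := (cvgrPdist_lt _ _).1 uU _ e4.
have tail N : \sum_(M <= n < N) u n.+1 <= e / 4%:R.
  have [MN|NM] := leqP M N; last by rewrite big_geq ?ltW// ltnW.
  have := ule N; rewrite (big_cat_nat _ MN)//= => le_U.
  move: uM => /(le_lt_trans (ler_norm _)); rewrite /series/= => ltU.
  by lra.
have cvL : cnorm (L - \sum_(0 <= n < M) c n.+1) <= e / 4%:R + e / 4%:R.
  have [N' _ hN'] := (cvgrPdist_lt _ _).1 ((cvg_complexP _ _).1 cL) _ e4.
  have /= := hN' (maxn M N') (leq_maxr _ _).
  rewrite sub0r normrN ger0_norm ?cnorm_ge0// (big_cat_nat _ (leq_maxl M N'))//=.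
  set S := \sum_(0 <= n < M) _; set S' := \sum_(M <= n < _) _ => lt1.
  have -> : L - S = (L - (S + S')) + S' by rewrite opprD addrA subrK.
  apply: le_trans (cnormD _ _) _; apply: lerD; first exact: ltW.
  apply: le_trans (cnorm_sum _ _ _) _; apply: le_trans (tail (maxn M N')).
  by apply: ler_sum => n _; apply: cu.
exists (maxn N0 M.+1) => // N /= /[!geq_max] /andP[N0N MN].
rewrite sub0r normrN ger0_norm ?cnorm_ge0//.
have : ((fun K => \prod_(p <- primes_below N) \sum_(0 <= k < K) b p k)
    : nat -> R[i]^o) @ \oo --> (\prod_(p <- primes_below N) B p : R[i]^o).
  apply: (@cvg_big R[i]^o) => [|p _]; first exact: mul_continuous.
  exact: bB.
move=> /cvg_complexP /cvgrPdist_lt /(_ _ e4) [K0 _ hK0].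
(* Large for the local sums to be close to [B], and above every exponent that
   occurs in a number up to [M]. *)
pose K := maxn K0 M.+1.
have /= := hK0 K (leq_maxl _ _); rewrite sub0r normrN ger0_norm ?cnorm_ge0//.
rewrite prod_sum_supported ?primes_below_uniq//.
set T := \sum_(n <- _) _; set P := \prod_(p <- _) _ => ltPT.
have TE : T = \sum_(n <- supported_numbers (primes_below N) K) c n.
  rewrite /T big_seq [RHS]big_seq; apply: eq_bigr => n n_in; rewrite -cb//.
    exact: supported_numbers_gt0 n_in.
  by move=> p; exact: logn_supported n_in.
have logn_small n p : (0 < n)%N -> (n <= M)%N -> (logn p n <= M)%N.
  move=> n0 nM; apply: leq_trans nM; case: n n0 => // n _.
  by rewrite ltnW// ltn_logl.
have TM : cnorm (T - \sum_(0 <= n < M) c n.+1) <= e / 4%:R.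
  have -> : \sum_(0 <= n < M) c n.+1 =
      \sum_(n <- supported_numbers (primes_below N) K | (n <= M)%N) c n.
    transitivity (\sum_(1 <= n < M.+1) c n); first by rewrite big_add1.
    rewrite -[RHS]big_filter; apply: perm_big.
    apply: uniq_perm; rewrite ?iota_uniq ?filter_uniq//.
      by rewrite supported_numbers_uniq// primes_below_uniq.
    move=> n; rewrite mem_filter mem_index_iota ltnS.
    apply/andP/andP => [[n0 nM]|[nM n_in]]; split => //; last first.
      exact: supported_numbers_gt0 n_in.
    apply: mem_supported_numbers => //; first exact: primes_below_uniq.
    - by rewrite /K leq_max orbT.
    - by move=> p; rewrite /K leq_max ltnS logn_small// orbT.
    - move=> p; rewrite mem_primes_below -leqNgt => Np.
      rewrite lognE (valP p) n0/= gtnNdvd//.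
      by apply: leq_ltn_trans nM _; apply: leq_trans MN Np.
  rewrite TE (bigID (fun n => (n <= M)%N))/= addrC addrK.
  apply: le_trans (cnorm_sum _ _ _) _; rewrite -big_filter.
  apply: (@le_trans _ _ (\sum_(n <- [seq n <- supported_numbers
      (primes_below N) K | ~~ (n <= M)%N]) u n)).
    rewrite big_seq [leRHS]big_seq; apply: ler_sum => n.
    by rewrite mem_filter => /andP[_ /supported_numbers_gt0 n0]; exact: cu.
  apply: (sum_uniq_tail u0 tail).
    by rewrite filter_uniq// supported_numbers_uniq// primes_below_uniq.
  by move=> n; rewrite mem_filter -ltnNge => /andP[].
have -> : L - P = (L - \sum_(0 <= n < M) c n.+1) -
    (T - \sum_(0 <= n < M) c n.+1) - (P - T).
  by ring.
apply: le_lt_trans (cnormD _ _) _; rewrite cnormN.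
apply: le_lt_trans (lerD (cnormD _ _) (lexx _)) _; rewrite cnormN.
by lra.
Qed.

End EulerProduct.

(** * Levels of a surjective inverse system *)

Section ProjectionsOntoLevels.

(** Along a cofinal chain a given element can be lifted one level at a time; the
    lifts determine all the other coordinates of a thread. *)
Lemma invlim_proj_surj_chain (I : Type) (le : rel I) (S : invsystem le)
    (e : nat -> I) :
  reflexive le -> transitive le -> surjective_system S ->
  (forall k, le (e k) (e k.+1)) -> (forall i, exists k, le i (e k)) ->
  forall y : S (e 0%N), exists x : invlim S, invlim_proj (e 0%N) x = y.
Proof.
move=> le_refl le_tr surj chain cofinal y.
pose lift k (z : S (e k)) := sval (cid (surj _ _ (chain k) z)).
have liftP k z : trans S (e k) (e k.+1) (@lift k z) = z.
  exact: svalP (cid (surj _ _ (chain k) z)).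
pose t := fix t k : S (e k) := if k is l.+1 then lift l (t l) else y.
have chain_le k l : (k <= l)%N -> le (e k) (e l).
  elim: l => [|l IH]; first by rewrite leqn0 => /eqP ->.
  rewrite leq_eqVlt => /orP[/eqP -> //|]; rewrite ltnS => /IH h.
  exact: le_tr h (chain l).
have tE k l : (k <= l)%N -> trans S (e k) (e l) (t l) = t k.
  elim: l => [|l IH]; first by rewrite leqn0 => /eqP ->; rewrite trans_id.
  rewrite leq_eqVlt => /orP[/eqP -> //|]; first by rewrite trans_id.
  rewrite ltnS => kl; rewrite -(trans_trans (chain_le _ _ kl) (chain l)).
  by rewrite /= liftP IH.
pose kk i := sval (cid (cofinal i)).
have kkP i : le i (e (kk i)) := svalP (cid (cofinal i)).
have tindep i k l : le i (e k) -> le i (e l) ->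
    trans S i (e k) (t k) = trans S i (e l) (t l).
  wlog kl : k l / (k <= l)%N.
    move=> h ik il; have [kl|/ltnW lk] := leqP k l; first exact: h.
    by apply/esym/h.
  by move=> ik il; rewrite -(tE _ _ kl) trans_trans// chain_le.
have xP i j : le i j ->
    trans S i j (trans S j (e (kk j)) (t (kk j))) =
    trans S i (e (kk i)) (t (kk i)).
  move=> ij; rewrite trans_trans//; apply: tindep => //.
  exact: le_tr ij (kkP j).
exists (mk_invlim xP); rewrite invlim_proj_mk.
by rewrite (tindep _ _ 0%N)// trans_id.
Qed.

Lemma invlim_proj_surj_dvd (S : invsystem dvd_pos) (n : posint) :
  surjective_system S ->
  forall y : S n, exists x : invlim S, invlim_proj n x = y.
Proof.
move=> surj.
have e_gt0 k : (0 < val n * k`!)%N by rewrite muln_gt0 (valP n) fact_gt0.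
(* The multiples [n * k`!] of [n] form a divisibility chain that every positive
   integer eventually divides. *)
pose e k : posint := exist (fun n => 0 < n)%N _ (e_gt0 k).
have e0 : e 0%N = n by apply/val_inj; rewrite /= muln1.
move: (@invlim_proj_surj_chain _ _ S e); rewrite e0; apply => //.
- by move=> i; apply: dvdnn.
- by move=> j i k; apply: dvdn_trans.
- by move=> k; rewrite /dvd_pos /= dvdn_mul// factS dvdn_mull.
- move=> i; exists (val i); rewrite /dvd_pos /= dvdn_mull// dvdn_fact//.
  by rewrite (valP i) leqnn.
Qed.

Lemma invlim_proj_surj_nat (S : invsystem leq) (k : nat) :
  surjective_system S ->
  forall y : S k, exists x : invlim S, invlim_proj k x = y.
Proof.
move=> surj; pose e l := (k + l)%N.
have e0 : e 0%N = k by rewrite /e addn0.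
move: (@invlim_proj_surj_chain _ _ S e); rewrite e0; apply => //.
- exact: leq_trans.
- by move=> l; rewrite /e leq_add2l.
- by move=> i; exists i; rewrite /e leq_addl.
Qed.

End ProjectionsOntoLevels.

Section Characters.
Context (R : realType) (I : Type) (le : rel I) (S : invsystem le) (m : nat).
Variable chi : invlim S -> R[i].
Hypotheses (m_gt0 : (0 < m)%N) (chi_char : is_mu_character m chi).

Lemma char_neq0 x : chi x != 0.
Proof.
apply/eqP => chi0; have := mu_charX chi_char x.
by rewrite chi0 expr0n eqn0Ngt m_gt0 => /esym/eqP; rewrite oner_eq0.
Qed.

Lemma char1 : chi 1%g = 1.
Proof.
apply: (mulfI (char_neq0 1%g)).
by rewrite -(mu_charM chi_char) mulg1 mulr1.
Qed.

Lemma charV x : chi x^-1%g = (chi x)^-1.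
Proof.
apply: (mulfI (char_neq0 x)).
by rewrite -(mu_charM chi_char) mulgV char1 divff ?char_neq0.
Qed.

End Characters.

(** * The index of [G(n)] in [A(n)] *)

Section LevelIndex.
Context (R : realType) (G A : invsystem dvd_pos).
Hypotheses (G_surj : surjective_system G) (A_surj : surjective_system A).
Variable r : sysmorphism G A.
Hypothesis r_inj : forall n : posint, injective (r n).
Variables (m : nat) (chi : invlim A -> R[i]).
Hypotheses (m_gt0 : (0 < m)%N) (chi_char : is_mu_character m chi).
Hypothesis chi_exact : exact_sequence m (lim_map r) chi.
Variable n : posint.

Definition trivial_on_kernel (i : nat) : bool :=
  `[< forall a : invlim A, invlim_proj n a = 1%g -> chi a ^+ i = 1 >].

(** Let [K_n] be the kernel of [A -> A(n)]. Since [chi] identifies [A / G] with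
    [mu_m], the index of [G(n)] in [A(n)] is that of [chi(K_n)] in [mu_m]. As
    [mu_m] is cyclic, this index is also the number of the exponents [i < m]
    for which [chi ^ i] is trivial on [K_n]. *)
Lemma card_level_index :
  #|A n| = (#|[pred i : 'I_m | trivial_on_kernel i]| * #|G n|)%N.
Proof.
have [z zm] := complex_primitive_root R m_gt0.
have chiP a : exists j, chi a = z ^+ j.
  have [i ->] := prim_rootP zm (mu_charX chi_char a); by exists i.
have chi_onto j : exists a, chi a = z ^+ j.
  have : [set w : R[i] | w ^+ m = 1] (z ^+ j).
    by rewrite /= exprAC (prim_expr_order zm) expr1n.
  by rewrite -(exact_right chi_exact) => -[a _ <-]; exists a.
(* [chi(K_n)] in exponent form: it is [{z ^+ j | s %| j}] for the least positive
   [s] with [D s]. *)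
pose D j := exists a, invlim_proj n a = 1%g /\ chi a = z ^+ j.
have D0 : D 0%N by exists 1%g; rewrite (char1 m_gt0 chi_char) expr0.
have Dm : D m by exists 1%g; rewrite (char1 m_gt0 chi_char) (prim_expr_order zm).
have DD j l : D j -> D l -> D (j + l)%N.
  move=> [a [a1 aj]] [b [b1 bl]]; exists (a * b)%g.
  rewrite (mu_charM chi_char) aj bl exprD; split => //.
  by change (invlim_proj n a * invlim_proj n b = 1)%g; rewrite a1 b1 mulg1.
have DB j l : D j -> D (j + l)%N -> D l.
  move=> [a [a1 aj]] [b [b1 bl]]; exists (a^-1 * b)%g; split.
    change ((invlim_proj n a)^-1 * invlim_proj n b = 1)%g.
    by rewrite a1 b1 mulg1 invg1.
  rewrite (mu_charM chi_char) (charV m_gt0 chi_char) aj bl exprD mulKf//.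
  by rewrite -aj (char_neq0 m_gt0 chi_char).
have Dex : exists j, (0 < j)%N && `[< D j >].
  by exists m; rewrite m_gt0; apply/asboolP.
case: (ex_minnP Dex) => s /andP[s0 /asboolP Ds] s_min.
have Dmul q : D (q * s)%N.
  by elim: q => [|q IH]; [rewrite mul0n|rewrite mulSn; apply: DD].
have DP j : D j <-> (s %| j)%N.
  split=> [Dj|/dvdnP[q ->]]; last exact: Dmul.
  have := DB _ (j %% s)%N (Dmul (j %/ s)%N); rewrite -divn_eq => /(_ Dj) Dr.
  rewrite /dvdn; case: posnP => // r0.
  have := s_min (j %% s)%N; rewrite r0 asboolT// => /(_ isT).
  by rewrite leqNgt ltn_mod s0.
have sm : (s %| m)%N by apply/DP.
have trivP i : trivial_on_kernel i = (m %/ s %| i)%N.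
  have -> : (m %/ s %| i)%N = (m %| s * i)%N.
    by rewrite -{2}(divnK sm) mulnC dvdn_pmul2l.
  rewrite (prim_order_dvd zm); apply/asboolP/eqP => [h|zsi a a1].
    by have [a [a1 az]] := Ds; rewrite exprM -az h.
  have [j aj] := chiP a; have /DP/dvdnP[q jE] : D j by exists a.
  by rewrite aj jE -exprM -mulnA mulnC exprM zsi expr1n.
have -> : #|[pred i : 'I_m | trivial_on_kernel i]| = s.
  have lt_m (t : 'I_s) : (t * (m %/ s) < m)%N.
    by rewrite -{2}(divnK sm) mulnC ltn_pmul2l// divn_gt0// dvdn_leq.
  have q0 : (0 < m %/ s)%N by rewrite divn_gt0// dvdn_leq.
  have f_inj : injective (fun t : 'I_s => Ordinal (lt_m t)).
    move=> t t' /(congr1 (@nat_of_ord m)) tt'; apply: val_inj; apply/eqP.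
    by rewrite -(eqn_pmul2r q0); apply/eqP.
  rewrite -[RHS]card_ord -(card_codom f_inj); apply: eq_card => i.
  rewrite inE trivP; apply/dvdnP/codomP => [[t it]|[t ->]]; last by exists t.
  have ts : (t < s)%N.
    have := ltn_ord i; rewrite it -{2}(divnK sm) mulnC.
    by rewrite ltn_pmul2l.
  by exists (Ordinal ts); apply: val_inj.
(* The elements [a_ j] with [j < s] represent the cosets of [G(n)] in [A(n)]. *)
pose a_ j := sval (cid (chi_onto j)).
have a_P j : chi (a_ j) = z ^+ j := svalP (cid (chi_onto j)).
have chi_r x : chi (lim_map r x) = 1.
  have : range (lim_map r) (lim_map r x) by exists x.
  by rewrite (exact_middle chi_exact).
pose f (w : 'I_s * G n) : A n := (r n w.2 * invlim_proj n (a_ w.1))%g.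
have f_inj : injective f.
  move=> [j x] [j' x'] /= e.
  have jj' : j = j'.
    have [X Xx] := invlim_proj_surj_dvd G_surj x.
    have [X' Xx'] := invlim_proj_surj_dvd G_surj x'.
    pose b := (lim_map r X * a_ j * (lim_map r X' * a_ j')^-1)%g.
    have b1 : invlim_proj n b = 1%g.
      change ((r n (invlim_proj n X) * invlim_proj n (a_ j)) *
        (r n (invlim_proj n X') * invlim_proj n (a_ j'))^-1 = 1)%g.
      by rewrite Xx Xx'; move: e; rewrite /f /= => ->; rewrite mulgV.
    have [t bt] := chiP b.
    have /DP/dvdnP[q tE] : D t by exists b.
    have : z ^+ (t + j') = z ^+ j.
      rewrite exprD -bt /b !(mu_charM chi_char) (charV m_gt0 chi_char).
      rewrite (mu_charM chi_char) !chi_r !mul1r !a_P mulfVK//.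
      by rewrite -a_P (char_neq0 m_gt0 chi_char).
    move/eqP; rewrite (eq_prim_root_expr zm) => /eqP.
    move/(congr1 (modn^~ s)); rewrite !modn_dvdm// tE modnMDl !modn_small//.
    by move/val_inj.
  by move: e; rewrite /f /= jj' => /mulIg /r_inj ->.
have f_surj y : exists w, f w = y.
  have [a ay] := invlim_proj_surj_dvd A_surj y.
  have [t at_] := chiP a.
  have [k [k1 kz]] := Dmul (t %/ s)%N.
  have js : (t %% s < s)%N by rewrite ltn_mod.
  pose b := (k^-1 * a * (a_ (t %% s)%N)^-1)%g.
  have : [set a | chi a = 1] b.
    rewrite /= /b !(mu_charM chi_char) !(charV m_gt0 chi_char) at_ kz a_P.
    have -> : z ^+ t = z ^+ (t %/ s * s) * z ^+ (t %% s)%N.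
      by rewrite -exprD -divn_eq.
    rewrite mulKf ?mulfV//.
      by rewrite -a_P (char_neq0 m_gt0 chi_char).
    by rewrite -kz (char_neq0 m_gt0 chi_char).
  rewrite -(exact_middle chi_exact) => -[X _ Xb].
  exists (Ordinal js, invlim_proj n X); rewrite /f /=.
  have -> : r n (invlim_proj n X) = invlim_proj n b by rewrite -Xb.
  change ((invlim_proj n k)^-1 * invlim_proj n a *
    (invlim_proj n (a_ (t %% s)%N))^-1 * invlim_proj n (a_ (t %% s)%N) = y)%g.
  by rewrite k1 invg1 mul1g mulgKV.
pose f' y := sval (cid (f_surj y)).
have f'K y : f (f' y) = y := svalP (cid (f_surj y)).
have f_bij : bijective f by exists f' => // w; apply: f_inj; rewrite f'K.
by rewrite -(bij_eq_card f_bij) card_prod card_ord.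
Qed.

End LevelIndex.

(** * Decomposition into primary components *)

Section Recombination.
Context (A : invsystem dvd_pos) (h : prime_decomposition A).

(** Equal primes give types that are only propositionally equal; the transition
    map between two such levels serves as the cast. *)
Lemma prime_thread_trans (x : forall p : primeint, invlim (primary A p))
    (p q : primeint) k l : val p = val q -> (k <= l)%N ->
  trans A (ppow p k) (ppow q l) (invlim_proj l (x q)) = invlim_proj k (x p).
Proof. by move=> /val_inj -> kl; apply: (invlim_projP (x q)). Qed.

Lemma recombination_coordinates (x : forall p : primeint, invlim (primary A p)) :
  exists a : invlim A, forall (n : posint) (q : seq_sub (primes (val n))),
    h n (invlim_proj n a) q =
    invlim_proj (logn (ssval q) (val n)) (x (prime_of q)).
Proof.
have ex (n : posint) : exists y : A n, forall q : seq_sub (primes (val n)),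
    h n y q = invlim_proj (logn (ssval q) (val n)) (x (prime_of q)).
  have [h' _ hK] := pd_map_bij h n.
  exists (h' [ffun q : seq_sub (primes (val n)) => (invlim_proj (logn (ssval q)
    (val n)) (x (prime_of q)) : A (ppart q))]) => q.
  by rewrite hK ffunE.
pose y n := sval (cid (ex n)); have yP n := svalP (cid (ex n)).
have h_inj n : injective (h n) by apply: bij_inj; apply: pd_map_bij.
have y_trans n1 n2 : dvd_pos n1 n2 -> trans A n1 n2 (y n2) = y n1.
  move=> n12; apply: h_inj; apply/ffunP => q1.
  have q2P : ssval q1 \in primes (val n2).
    have := ssvalP q1; rewrite !mem_primes => /and3P[-> _ /= qn1].
    by rewrite (valP n2) (dvdn_trans qn1 n12).
  rewrite (pd_map_trans h n12 _ (q2 := SeqSub q2P))// !yP.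
  by apply: prime_thread_trans => //; apply: dvdn_leq_log => //; exact: (valP n2).
by exists (mk_invlim y_trans) => n q; rewrite invlim_proj_mk yP.
Qed.

Lemma level_eq1 (n : posint) (y : A n) : (forall q, h n y q = 1%g) -> y = 1%g.
Proof.
move=> hy; have h_inj : injective (h n) by apply: bij_inj; apply: pd_map_bij.
have h1 : h n 1%g = 1%g.
  by apply: (mulgI (h n 1%g)); rewrite -(pd_mapM h) !mulg1.
by apply: h_inj; rewrite h1; apply/ffunP => q; rewrite hy ffunE.
Qed.

(** Every family of local components comes from an element of [A], and the
    element can be tested for triviality at level [n] on its components: this is
    the part of the isomorphism of [A] with the product of the [A_p] that the
    characters see. *)
Lemma recombination (x : forall p : primeint, invlim (primary A p)) :
  exists a : invlim A, (forall p, component h p a = x p) /\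
    forall n : posint,
      (forall p : primeint, invlim_proj (logn (val p) (val n)) (x p) = 1%g) ->
      invlim_proj n a = 1%g.
Proof.
have [a aP] := recombination_coordinates x; exists a; split=> [p|n xn].
  apply: invlim_proj_inj => k; rewrite invlim_proj_mk aP.
  by apply: prime_thread_trans => //=; rewrite pfactorK//; exact: (valP p).
by apply: level_eq1 => q; rewrite aP; exact: (xn (prime_of q)).
Qed.

(** The number 1 has no prime divisor, so the decomposition of [A(1)] is an empty
    product. *)
Lemma primary_level0 (p : primeint) (y : primary A p 0%N) : y = 1%g.
Proof. by apply: (@level_eq1 (ppow p 0)) => -[q qP]; exfalso. Qed.

Lemma component_proj1 (n : posint) (a : invlim A) (p : primeint) :
  invlim_proj n a = 1%g ->
  invlim_proj (logn (val p) (val n)) (component h p a) = 1%g.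
Proof.
move=> a1; case: (posnP (logn (val p) (val n))) => [->|].
  exact: primary_level0.
case kE : (logn _ _) => [//|k] _; rewrite componentE.
have kn : dvd_pos (ppow p k.+1) n by rewrite /dvd_pos /= -kE pfactor_dvdnn.
have h1 : h (ppow p k.+1) 1%g = 1%g.
  by apply: (mulgI (h (ppow p k.+1) 1%g)); rewrite -(pd_mapM h) !mulg1.
rewrite -(invlim_projP a kn) a1 (trans1 A kn) h1 ffunE (trans1 A)//.
by apply: ppow_dvdP => //=; rewrite pfactorK//; exact: (valP p).
Qed.

Lemma card_level_decomposition (n : posint) :
  #|A n| = (\prod_(q : seq_sub (primes (val n)))
              #|A (ppow (prime_of q) (logn (ssval q) (val n)))|)%N.
Proof.
rewrite (bij_eq_card (pd_map_bij h n)) card_dep_ffun foldrE big_map.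
by rewrite big_enum.
Qed.

Lemma card_level0 (p : primeint) : #|A (ppow p 0)| = 1%N.
Proof. by rewrite card_level_decomposition big1// => -[q qP]; exfalso. Qed.

Lemma card_level_prod (n : posint) (ps : seq primeint) : uniq ps ->
  (forall p : primeint, p \notin ps -> logn (val p) (val n) = 0%N) ->
  #|A n| = (\prod_(p <- ps) #|A (ppow p (logn (val p) (val n)))|)%N.
Proof.
move=> ups nps; rewrite card_level_decomposition.
rewrite [RHS](bigID (fun p : primeint => (0 < logn (val p) (val n))%N))/=.
rewrite [X in (_ * X)%N]big1 ?muln1; last first.
  by move=> p; rewrite -eqn0Ngt => /eqP ->; exact: card_level0.
pose qs := map (@prime_of (val n)) (index_enum (seq_sub (primes (val n)))).
transitivity (\prod_(p <- qs) #|A (ppow p (logn (val p) (val n)))|)%N.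
  by rewrite big_map.
rewrite -[RHS]big_filter; apply: perm_big; apply: uniq_perm.
- rewrite map_inj_uniq ?index_enum_uniq// => q q' /(congr1 (@proj1_sig _ _)) /= qq'.
  exact: val_inj.
- by rewrite filter_uniq.
- move=> p; rewrite mem_filter logn_gt0.
  apply/mapP/andP => [[q _ ->]|[pn pps]]; last first.
    by exists (SeqSub pn); rewrite ?mem_index_enum//; exact: val_inj.
  split; first exact: ssvalP q.
  apply: contraTT (ssvalP q) => /nps /=; rewrite -logn_gt0 => ->.
  by [].
Qed.

End Recombination.

Lemma prod_if_all (R : comNzRingType) (I : Type) (s : seq I) (t : pred I)
    (x : I -> R) :
  \prod_(i <- s) (if t i then x i else 0) =
  if all t s then \prod_(i <- s) x i else 0.
Proof.
elim: s => [|i s IH]; first by rewrite !big_nil.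
rewrite !big_cons IH /=; case: (t i) => /=; last by rewrite mul0r.
by case: all; rewrite ?mulr0.
Qed.

Lemma possuccK (n : posint) : possucc (val n).-1 = n.
Proof. by apply: val_inj; rewrite /= prednK// (valP n). Qed.

Lemma multiplicative_prod (R : realType) (g : nat -> R[i]) (ps : seq primeint)
    (n : nat) : multiplicative_fun g -> uniq ps -> (0 < n)%N ->
  (forall p : primeint, p \notin ps -> logn (val p) n = 0%N) ->
  g n = \prod_(p <- ps) g (val p ^ logn (val p) n)%N.
Proof.
move=> gm; elim: ps n => [|p ps IH] n /= ups n0 nps.
  rewrite big_nil; suff -> : n = 1%N by exact: multiplicative1 gm.
  apply: eqn_from_log => // q.
  rewrite logn1; case: (boolP (prime q)) => qp; first exact: (nps (exist _ q qp)).
  by rewrite lognE (negbTE qp).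
move: ups => /andP[pps ups].
have [k pk nE] := pfactor_coprime (valP p) n0.
have k0 : (0 < k)%N by move: n0; rewrite nE muln_gt0 => /andP[].
have lk (q : primeint) :
    logn (val q) n = (logn (val q) k + if q == p then logn (val p) n else 0)%N.
  by rewrite {1}nE lognM ?ppow_gt0// logn_ppow.
rewrite big_cons {1}nE (multiplicativeM gm) ?ppow_gt0//; last first.
  by rewrite coprime_sym coprimeXl.
rewrite mulrC; congr (_ * _); rewrite IH//.
  rewrite big_seq [RHS]big_seq; apply: eq_bigr => q q_in; rewrite lk.
  by case: eqP q_in => [->|_]; rewrite ?(negbTE pps) ?addn0.
move=> q qps; have [->|qp] := eqVneq q p; first by rewrite logn_coprime.
have := nps q; rewrite inE negb_or qp qps => /(_ isT) /eqP.
by rewrite lk addn_eq0 => /andP[/eqP].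
Qed.

Section KernelTriviality.
Context (R : realType) (A : invsystem dvd_pos) (h : prime_decomposition A).
Variables (m : nat) (chi : invlim A -> R[i]).
Variable chip : forall p : primeint, invlim (primary A p) -> R[i].
Arguments chip : clear implicits.
Hypotheses (m_gt0 : (0 < m)%N) (chip_char : forall p, is_mu_character m (chip p)).
Hypothesis chi_prod : forall alpha : invlim A, chi alpha =
  \big[*%R/1]_(p \in [set: primeint]) chip p (component h p alpha).

Definition trivial_on_local_kernel (i : nat) (p : primeint) (k : nat) : bool :=
  `[< forall x : invlim (primary A p),
        invlim_proj k x = 1%g -> chip p x ^+ i = 1 >].

(** The kernel of [A -> A(n)] is the product of the kernels of
    [A_p -> A(p^k)] with [p^k] the exact power of [p] in [n], including [k = 0]
    for the primes that do not divide [n]. *)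
Lemma trivial_on_kernel_local (n : posint) (i : nat) :
  trivial_on_kernel chi n i <->
  (forall p : primeint, trivial_on_local_kernel i p (logn (val p) (val n))).
Proof.
split=> [/asboolP chi1 p|chip1]; apply/asboolP.
  move=> x x1.
  (* Lift [x] to the element of [A] with trivial components away from [p]. *)
  pose x_ := eqtype.dfwith (fun q => 1%g : invlim (primary A q)) x.
  have [a [ax an]] := recombination h x_.
  have <- : chi a = chip p x.
    rewrite chi_prod -(fsbig_widen [set p])//.
      by rewrite fsbig_set1 ax /x_ eqtype.dfwith_in.
    move=> q [_ /= qp]; rewrite ax /x_ eqtype.dfwith_out.
      exact: char1 m_gt0 (chip_char q).
    by apply/eqP => pq; apply: qp.
  apply: chi1; apply: an => q; rewrite /x_.
  by case: eqtype.dfwithP => [//|q' _].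
move=> a a1; rewrite chi_prod -prodrXl big1// => p _.
by have /asboolP := chip1 p; apply; exact: component_proj1.
Qed.

End KernelTriviality.

(** * Complex integrals and Haar measure *)

Section ComplexIntegration.
Context d (T : measurableType d) (R : realType) (mu : {finite_measure set T -> \bar R}).

Lemma Rintegral_step (I : Type) (s : seq I) (c : I -> R) (B : I -> set T) :
  (forall i, measurable (B i)) ->
  mu.-integrable setT (fun x => (\sum_(i <- s) c i * \1_(B i) x)%:E) /\
  Rintegral mu setT (fun x => \sum_(i <- s) c i * \1_(B i) x) =
  \sum_(i <- s) c i * fine (mu (B i)).
Proof.
move=> mB; elim: s => [|i s [intS IH]].
  split; under eq_fun do rewrite big_nil; first exact: integrable0.
  by rewrite big_nil Rintegral_cst// mul0r.
have int1 : mu.-integrable setT (EFin \o (\1_(B i) : T -> R)).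
  exact: integrable_indic.
have intc : mu.-integrable setT (EFin \o (fun x => c i * \1_(B i) x)).
  by apply: (@integrableZl _ _ _ mu setT measurableT (c i)) int1.
split; under eq_fun do rewrite big_cons.
  by under eq_fun do rewrite EFinD; apply: integrableD.
rewrite big_cons RintegralD// IH RintegralZl//; congr (_ * _ + _).
by rewrite /Rintegral/= integral_indic// setIT.
Qed.

(** Step functions are the only functions whose integral is computed directly:
    a partial sum of [gtilde] times a power of a character of finite order takes
    finitely many values. *)
Lemma complex_integral_step (I : Type) (s : seq I) (c : I -> R[i])
    (B : I -> set T) (f : T -> R[i]) : (forall i, measurable (B i)) ->
  (forall x, f x = \sum_(i <- s) c i * \1_(B i) x) ->
  [/\ measurable_fun setT (fun x => complex.Re (f x)),
      measurable_fun setT (fun x => complex.Im (f x)) &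
      complex_integral mu f = \sum_(i <- s) c i * (fine (mu (B i)))%:C%C].
Proof.
move=> mB fE.
have RecM (z : R[i]) (y : R) : complex.Re (z * y%:C%C) = complex.Re z * y.
  by case: z => a b /=; rewrite mulr0 subr0.
have ImcM (z : R[i]) (y : R) : complex.Im (z * y%:C%C) = complex.Im z * y.
  by case: z => a b /=; rewrite mulr0 add0r.
have indC i x : \1_(B i) x = (\1_(B i) x : R)%:C%C :> R[i].
  by rewrite !indicE; case: (_ \in _).
have ReE : (fun x => complex.Re (f x)) =
    (fun x => \sum_(i <- s) complex.Re (c i) * \1_(B i) x).
  apply/funext => x; rewrite fE Re_sum; apply: eq_bigr => i _.
  by rewrite indC RecM.
have ImE : (fun x => complex.Im (f x)) =
    (fun x => \sum_(i <- s) complex.Im (c i) * \1_(B i) x).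
  apply/funext => x; rewrite fE Im_sum; apply: eq_bigr => i _.
  by rewrite indC ImcM.
have [intR RE] := @Rintegral_step _ s (fun i => complex.Re (c i)) _ mB.
have [intI IE] := @Rintegral_step _ s (fun i => complex.Im (c i)) _ mB.
rewrite ReE ImE; split.
- by apply/measurable_EFinP; exact: measurable_int intR.
- by apply/measurable_EFinP; exact: measurable_int intI.
- rewrite /complex_integral ReE ImE RE IE; apply/eqP.
  rewrite eq_complex/= Re_sum Im_sum; apply/andP; split; apply/eqP;
    by apply: eq_bigr => i _; rewrite ?RecM ?ImcM.
Qed.

Lemma complex_dominated_convergence (F_ : nat -> T -> R[i]) (F : T -> R[i])
    (D : T -> \bar R) :
  (forall N, measurable_fun setT (fun x => complex.Re (F_ N x))) ->
  (forall N, measurable_fun setT (fun x => complex.Im (F_ N x))) ->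
  measurable_fun setT (fun x => complex.Re (F x)) ->
  measurable_fun setT (fun x => complex.Im (F x)) ->
  {ae mu, forall x, (F_ ^~ x : nat -> R[i]^o) @ \oo --> (F x : R[i]^o)} ->
  mu.-integrable setT D ->
  (forall N x, ((cnorm (F_ N x))%:E <= D x)%E) ->
  complex_integrable mu F /\
  ((fun N => complex_integral mu (F_ N)) : nat -> R[i]^o) @ \oo -->
    (complex_integral mu F : R[i]^o).
Proof.
move=> mRe_ mIm_ mRe mIm FF intD FD.
have dc (q : R[i] -> R) : (forall z, `|q z| <= cnorm z) ->
    (forall N, measurable_fun setT (fun x => q (F_ N x))) ->
    measurable_fun setT (fun x => q (F x)) ->
    {ae mu, forall x, (fun N => q (F_ N x)) @ \oo --> q (F x)} ->
    mu.-integrable setT (fun x => (q (F x))%:E) /\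
    (fun N => Rintegral mu setT (fun x => q (F_ N x))) @ \oo -->
      Rintegral mu setT (fun x => q (F x)).
  move=> qn mq_ mq qF.
  have [|||||intq _ cvq] := @dominated_convergence _ T R mu setT measurableT
    (fun N x => (q (F_ N x))%:E) (fun x => (q (F x))%:E) D.
  - by move=> N; apply/measurable_EFinP.
  - exact/measurable_EFinP.
  - by apply: filterS qF => x qx _; apply: cvg_EFin => //; exact: nearW.
  - exact: intD.
  - apply: aeW => x N _; apply: le_trans (FD N x).
    by rewrite /= lee_fin.
  split => //; apply: fine_cvg; rewrite /Rintegral fineK//.
  exact: integrable_fin_num.
have [|intR cvR] := dc _ (@norm_Re_le R) mRe_ mRe.
  by apply: filterS FF => x /cvg_ReImP[].
have [|intI cvI] := dc _ (@norm_Im_le R) mIm_ mIm.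
  by apply: filterS FF => x /cvg_ReImP[].
by split; [split|apply/cvg_ReImP; split].
Qed.

End ComplexIntegration.

Section HaarMeasure.
Context (R : realType) (S : invsystem leq).
Hypothesis S_surj : surjective_system S.
Variable nu : probability (borel S) R.
Hypothesis nu_haar : is_haar nu.

Lemma invlim_proj_open (k : nat) (y : S k) :
  open [set x : invlim S | invlim_proj k x = y].
Proof.
have cont : continuous
    (fun x : prod_topology (fun i => discrete_topology (S i)) => x k).
  exact: (@proj_continuous nat (fun i => discrete_topology (S i)) k).
have op : open ((fun x : prod_topology (fun i => discrete_topology (S i)) =>
    x k) @^-1` [set y]).
  by move/continuousP: cont; apply; exact: discrete_open.
have contv := @initial_continuous (invlim S) _ (set_val : invlim S -> _).
by move/continuousP: contv => /(_ _ op).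
Qed.

Lemma measurable_open (B : set (invlim S)) :
  open B -> measurable (B : set (borel S)).
Proof. by move=> oB; apply: sub_sigma_algebra. Qed.

Lemma measurable_level (k : nat) (y : S k) :
  measurable ([set x | invlim_proj k x = y] : set (borel S)).
Proof. by apply: measurable_open; exact: invlim_proj_open. Qed.

Lemma haar_translate (a : invlim S) (B C : set (invlim S)) :
  measurable (B : set (borel S)) -> (forall x, B x <-> C (a * x)%g) ->
  nu C = nu B.
Proof.
move=> mB BC; rewrite -(nu_haar a mB); congr (nu _).
apply/seteqP; split=> x /=; last by move=> [y /BC ? <-].
move=> Cx; exists (a^-1 * x)%g; last by rewrite mulKVg.
by apply/BC; rewrite mulKVg.
Qed.

(** The fibres of the projection to level [k] are translates of each other and
    partition the group. *)
Lemma haar_kernel (k : nat) :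
  nu [set x | invlim_proj k x = 1%g] = (#|S k|%:R^-1)%:E.
Proof.
pose F (y : S k) := ([set x | invlim_proj k x = y] : set (borel S)).
have FE y : nu (F y) = nu (F 1%g).
  have [a ay] := invlim_proj_surj_nat S_surj y.
  apply: (@haar_translate a); first exact: measurable_level.
  move=> x; rewrite /F /=.
  change (invlim_proj k x = 1%g <-> (invlim_proj k a * invlim_proj k x)%g = y).
  rewrite ay; split=> [->|e]; first by rewrite mulg1.
  by apply: (mulgI y); rewrite mulg1.
have UF : \bigcup_(y in [set: S k]) F y = setT.
  by apply/seteqP; split=> // x _; exists (invlim_proj k x).
have fin : finite_set [set: S k] by exact: finite_finset.
have mF y : [set: S k] y -> measurable (F y) by move=> _; exact: measurable_level.
have tF : trivIset [set: S k] F.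
  by move=> y y' _ _ [x [/= <- <-]].
have := measure_fin_bigcup nu fin tF mF.
rewrite UF => /(etrans (esym (probability_setT nu))).
have -> : [set: S k] = [set` index_enum (S k)].
  by apply/seteqP; split=> // y _ /=; exact: mem_index_enum.
rewrite -fsbig_seq ?index_enum_uniq// (eq_bigr _ (fun y _ => FE y)).
have nuF1 : nu (F 1%g) = (fine (nu (F 1%g)))%:E 
  by rewrite fineK// fin_num_measure//; exact: measurable_level.
rewrite -/(F 1%g) nuF1 sumEFin sumr_const => -[e]; congr EFin.
apply: (mulIf (x := #|S k|%:R)).
  by rewrite pnatr_eq0 -lt0n; apply/card_gt0P; exists 1%g.
rewrite mulVf; last first.
  by rewrite pnatr_eq0 -lt0n; apply/card_gt0P; exists 1%g.
by rewrite mulr_natr [RHS]e.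
Qed.

End HaarMeasure.

(** * The local factor at a prime *)

Section CharacterMoments.
Context (R : realType) (S : invsystem leq).
Hypothesis S_surj : surjective_system S.
Variable nu : probability (borel S) R.
Hypothesis nu_haar : is_haar nu.
Variables (m : nat) (psi : invlim S -> R[i]).
Hypotheses (m_gt0 : (0 < m)%N) (psi_char : is_mu_character m psi).
Variable rs : seq R[i].
Hypotheses (rs_uniq : uniq rs) (mem_rs : forall w, (w \in rs) = (w ^+ m == 1)).

Definition kernel_fiber (k : nat) (w : R[i]) : set (borel S) :=
  [set x : invlim S | invlim_proj k x = 1%g /\ psi x = w].

(** [psi] is only continuous for the metric topology; a fibre is the preimage of
    a point, which is closed. *)
Lemma measurable_kernel_fiber k w : measurable (kernel_fiber k w).
Proof.
have -> : kernel_fiber k w =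
    ([set x | invlim_proj k x = 1%g] : set (borel S)) `&`
    ([set x : invlim S | psi x = w] : set (borel S)).
  by [].
apply: measurableI; first exact: measurable_level.
rewrite -[X in measurable X]setCK; apply: measurableC; apply: measurable_open.
have cl : closed [set w : R[i]^o].
  by apply: accessible_closed_set1; apply: hausdorff_accessible; exact: norm_hausdorff.
have op : open (~` [set w : R[i]^o]) by rewrite openC.
by move/continuousP: (mu_char_continuous psi_char) => /(_ _ op).
Qed.

Lemma kernel_fiber_translate k (a : invlim S) w : invlim_proj k a = 1%g ->
  nu (kernel_fiber k (psi a * w)) = nu (kernel_fiber k w).
Proof.
move=> a1; apply: (haar_translate nu_haar (a := a)).
  exact: measurable_kernel_fiber.
move=> x; rewrite /kernel_fiber/=.
change ((invlim_proj k x = 1%g /\ psi x = w) <->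
  ((invlim_proj k a * invlim_proj k x)%g = 1%g /\ psi (a * x)%g = psi a * w)).
rewrite a1 mul1g (mu_charM psi_char); split=> -[-> e]; split=> //.
  by rewrite e.
exact: mulfI (char_neq0 m_gt0 psi_char a) _ _ e.
Qed.

Lemma kernel_fiber_partition k :
  \sum_(w <- rs) fine (nu (kernel_fiber k w)) = #|S k|%:R^-1.
Proof.
have fin w : nu (kernel_fiber k w) \is a fin_num.
  by rewrite fin_num_measure//; exact: measurable_kernel_fiber.
apply: EFin_inj; rewrite -sumEFin -(haar_kernel S_surj nu_haar k).
rewrite (eq_bigr (fun w => nu (kernel_fiber k w))); last first.
  by move=> w _; rewrite fineK.
rewrite fsbig_seq// -measure_fin_bigcup//.
- congr (nu _); apply/seteqP; split=> [x [w _ [? _]] //|x x1].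
  by exists (psi x) => //=; rewrite mem_rs (mu_charX psi_char).
- by move=> w w' _ _ [x [[_ <-] [_ <-]]].
- by move=> w _; exact: measurable_kernel_fiber.
Qed.

(** Orthogonality: the left-hand side is the integral of [psi ^ i] over the
    kernel of the projection to level [k]. An element [a] of the kernel with
    [psi a ^+ i != 1] permutes the fibres of [psi] by translation and thereby
    multiplies the integral by [psi a ^+ i], which forces it to vanish. *)
Lemma character_moment k i :
  \sum_(w <- rs) w ^+ i * (fine (nu (kernel_fiber k w)))%:C%C =
  if `[< forall x, invlim_proj k x = 1%g -> psi x ^+ i = 1 >]
  then (#|S k|%:R)^-1 else 0.
Proof.
case: asboolP => [psi1|psiN1].
  have -> : (#|S k|%:R^-1 : R[i]) = (#|S k|%:R^-1)%:C%C.
    by rewrite fmorphV rmorph_nat.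
  rewrite -(kernel_fiber_partition k) rmorph_sum; apply: eq_bigr => w _.
  have [[x [x1 xw]]|N] := pselect (exists x, kernel_fiber k w x).
    by rewrite -xw psi1// mul1r.
  have -> : kernel_fiber k w = set0.
    by apply/seteqP; split=> // x wx; apply: N; exists x.
  by rewrite measure0 mulr0.
have [a [a1 ai]] : exists a, invlim_proj k a = 1%g /\ psi a ^+ i != 1.
  apply: contrapT => h; apply: psiN1 => x x1; apply/eqP/negPn/negP => xi.
  by apply: h; exists x.
set Sm := \sum_(w <- rs) _.
suff SmE : psi a ^+ i * Sm = Sm.
  apply/eqP; have /eqP := SmE; rewrite -subr_eq0 -{2}[Sm]mul1r -mulrBl mulf_eq0.
  by rewrite subr_eq0 (negbTE ai).
have perm_rs : perm_eq (map ( *%R (psi a)) rs) rs.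
  have a0 := char_neq0 m_gt0 psi_char a.
  apply: uniq_perm => //.
    by rewrite map_inj_uniq//; exact: mulfI.
  move=> w; apply/mapP/idP => [[v v_in ->]|w_in].
    by move: v_in; rewrite !mem_rs exprMn (mu_charX psi_char) mul1r.
  exists ((psi a)^-1 * w); last by rewrite mulVKf.
  by move: w_in; rewrite !mem_rs exprMn exprVn (mu_charX psi_char) invr1 mul1r.
rewrite [in RHS]/Sm -(perm_big _ perm_rs)/= big_map mulr_sumr.
by apply: eq_bigr => w _; rewrite kernel_fiber_translate// exprMn mulrA.
Qed.

End CharacterMoments.

Section LocalFactor.
Context (R : realType) (A : invsystem dvd_pos) (g : nat -> R[i]) (p : primeint).
Hypothesis A_surj : surjective_system A.
Variable nu : probability (borel (primary A p)) R.
Hypothesis nu_haar : is_haar nu.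
Variables (m : nat) (psi : invlim (primary A p) -> R[i]).
Hypotheses (m_gt0 : (0 < m)%N) (psi_char : is_mu_character m psi).
Variable C : R.
Hypothesis summable : forall N,
  \sum_(0 <= k < N) cnorm (g (val p ^ k)%N) / #|A (ppow p k)|%:R <= C.

Let S := primary A p.

Lemma primary_surj : surjective_system S.
Proof. by move=> k l kl y; apply: A_surj; exact: ppow_dvd. Qed.

(** Dominates the norms of all partial sums of [gtilde]; where it is finite, they
    converge. *)
Definition gtilde_bound (x : borel S) : \bar R :=
  (\sum_(0 <= k <oo) (cnorm (g (val p ^ k)%N) * \1_(@ker_proj A p k) x)%:E)%E.

Lemma measurable_ker_proj k : measurable (@ker_proj A p k : set (borel S)).
Proof. exact: measurable_level. Qed.

Lemma gtilde_bound_integrable : nu.-integrable setT gtilde_bound.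
Proof.
have mf k : measurable_fun setT
    (fun x : borel S => (cnorm (g (val p ^ k)%N) * \1_(@ker_proj A p k) x)%:E).
  apply/measurable_EFinP; apply: measurable_funM => //.
  by apply: measurable_indic; exact: measurable_ker_proj.
have f0 k (x : borel S) :
    (0 <= (cnorm (g (val p ^ k)%N) * \1_(@ker_proj A p k) x)%:E)%E.
  by rewrite lee_fin mulr_ge0// cnorm_ge0.
have G0 x : (0 <= gtilde_bound x)%E by apply: nneseries_ge0 => k _ _; exact: f0.
apply/integrableP; split.
  by apply: ge0_emeasurable_sum => // k x _ _; exact: f0.
under eq_integral do rewrite gee0_abs//.
rewrite integral_nneseries//.
apply: (@le_lt_trans _ _ C%:E); last exact: ltry.
apply: lime_le.
  apply: is_cvg_nneseries => k _ _; apply: integral_ge0 => x _; exact: f0.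
apply: nearW => N /=.
apply: le_trans (_ : (_ <= (\sum_(0 <= k < N)
    cnorm (g (val p ^ k)%N) / #|A (ppow p k)|%:R)%:E)%E) _; last first.
  by rewrite lee_fin.
rewrite -sumEFin; apply: lee_sum => k _.
under eq_integral do rewrite EFinM.
rewrite ge0_integralZl//.
- rewrite integral_indic ?setIT//; last exact: measurable_ker_proj.
  by rewrite EFinM -(haar_kernel primary_surj nu_haar k).
- by apply/measurable_EFinP; apply: measurable_indic; exact: measurable_ker_proj.
- by rewrite lee_fin cnorm_ge0.
Qed.

Lemma cnorm_gtilde_partial N (x : borel S) :
  ((\sum_(0 <= k < N) cnorm (g (val p ^ k)%N * \1_(@ker_proj A p k) x))%:E
     <= gtilde_bound x)%E.
Proof.
rewrite -sumEFin.
rewrite (eq_bigr (fun k => (cnorm (g (val p ^ k)%N) * \1_(@ker_proj A p k) x)%:E)).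
  apply: nneseries_lim_ge => k _; by rewrite lee_fin mulr_ge0// cnorm_ge0.
move=> k _; rewrite cnormM !indicE; case: (_ \in _) => /=.
  by rewrite /cnorm normr1.
by rewrite cnorm0.
Qed.

Lemma gtilde_partial_ae :
  {ae nu, forall x, cvgn (gtilde_partial g x)}.
Proof.
have := integrable_ae measurableT gtilde_bound_integrable.
apply: filterS => x /(_ I) fin.
have [l gl] : exists l : R[i], (gtilde_partial g x @ \oo --> (l : R[i]^o)).
  apply: (@abs_series_cvg _ _ (fine (gtilde_bound x))) => N.
  by rewrite -lee_fin fineK//; exact: cnorm_gtilde_partial.
by apply/cvg_ex; exists l.
Qed.

(** A point other than 1 leaves the kernels from some level on, so 1 is the only
    point where the series defining [gtilde] may diverge. *)
Lemma gtilde_partial_stationary (x : invlim S) k N : invlim_proj k x != 1%g ->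
  (k <= N)%N -> gtilde_partial g x N = gtilde_partial g x k.
Proof.
move=> xk kN; rewrite /gtilde_partial (big_cat_nat _ kN)//= [X in _ + X]big1_seq.
  by rewrite addr0.
move=> l /andP[_]; rewrite mem_index_iota => /andP[kl _].
rewrite indicE memNset ?mulr0// => /= x1; move/eqP: xk; apply.
by rewrite -(invlim_projP x kl) x1; apply: (@trans1 _ _ S).
Qed.

Lemma measurable_one : measurable ([set 1%g] : set (borel S)).
Proof.
have -> : ([set 1%g] : set (borel S)) = \bigcap_k (@ker_proj A p k : set (borel S)).
  apply/seteqP; split=> [x /= -> k _ //|x x1 /=].
  by apply: invlim_proj_inj => k; exact: (x1 k I).
by apply: bigcapT_measurable => k; exact: measurable_ker_proj.
Qed.

(** The partial sums converge almost everywhere and are dominated by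
    [gtilde_bound], so the integral can be taken term by term, and orthogonality
    evaluates each term. *)
Lemma local_factor (i : nat) :
  complex_integrable nu (fun x => gtilde g x * psi x ^+ i) /\
  ((fun N => \sum_(0 <= k < N) g (val p ^ k)%N *
     (if `[< forall x : invlim S, invlim_proj k x = 1%g -> psi x ^+ i = 1 >]
      then (#|A (ppow p k)|%:R)^-1 else 0)) : nat -> R[i]^o) @ \oo -->
    (complex_integral nu (fun x => gtilde g x * psi x ^+ i) : R[i]^o).
Proof.
have [rs [rs_uniq mem_rs]] := unity_roots_enum R m_gt0.
pose F_ N (x : borel S) : R[i] := gtilde_partial g x N * psi x ^+ i.
pose F (x : borel S) : R[i] := gtilde g x * psi x ^+ i.
(* The [k]-th term of [F_ N] is constant on each fibre of [psi] in the kernel at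
   level [k]. *)
pose js N := [seq (k, w) | k <- iota 0 N, w <- rs].
have F_E N x : F_ N x = \sum_(j <- js N)
    g (val p ^ j.1)%N * j.2 ^+ i * \1_(kernel_fiber psi j.1 j.2) x.
  rewrite /F_ /gtilde_partial mulr_suml big_allpairs/= /index_iota subn0.
  apply: eq_bigr => k _; rewrite (bigD1_seq (psi x))//=; last first.
    by rewrite mem_rs (mu_charX psi_char).
  rewrite big1 ?addr0; last first.
    move=> w /eqP wx; rewrite indicE memNset ?mulr0// => -[_ xw].
    by apply: wx; rewrite xw.
  rewrite -!mulrA; congr (_ * _); rewrite mulrC; congr (_ * _).
  rewrite !indicE; congr (_%:R); congr nat_of_bool.
  by apply/idP/idP => /set_mem x1; apply/mem_set; [split|case: x1].
have mB (j : nat * R[i]) : measurable (kernel_fiber psi j.1 j.2).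
  exact: measurable_kernel_fiber psi_char _ _.
have step N := complex_integral_step nu mB (F_E N).
have intE N : complex_integral nu (F_ N) = \sum_(0 <= k < N) g (val p ^ k)%N *
     (if `[< forall x : invlim S, invlim_proj k x = 1%g -> psi x ^+ i = 1 >]
      then (#|A (ppow p k)|%:R)^-1 else 0).
  have [_ _ ->] := step N; rewrite big_allpairs/= /index_iota subn0.
  apply: eq_bigr => k _.
  rewrite -(character_moment primary_surj nu_haar m_gt0 psi_char rs_uniq mem_rs).
  by rewrite mulr_sumr; apply: eq_bigr => w _; rewrite mulrA.
have mF (q : R[i] -> R) : (q = (fun z => complex.Re z) \/ q = (fun z => complex.Im z)) ->
    (forall N, measurable_fun setT (fun x => q (F_ N x))) ->
    measurable_fun setT (fun x => q (F x)).
  move=> qE mq.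
  (* Replacing the value at 1 by that of the limit gives measurable functions
     converging everywhere, whatever the value of [gtilde] at 1 is. *)
  pose H N (x : borel S) := q (F 1%g) * \1_[set 1%g] x +
      q (F_ N x) * \1_(~` [set 1%g]) x : R.
  apply: (@measurable_fun_cvg _ _ _ setT H).
    move=> N; apply: measurable_funD; apply: measurable_funM => //.
      by apply: measurable_indic; exact: measurable_one.
    by apply: measurable_indic; apply: measurableC; exact: measurable_one.
  move=> x _; have [->|x1] := pselect (x = 1%g :> invlim S).
    rewrite (_ : H^~ _ = fun=> q (F 1%g)); first exact: cvg_cst.
    apply/funext => N; rewrite /H !indicE mem_set// memNset/=; last exact.
    by rewrite mulr1 mulr0 addr0.
  have [k xk] : exists k, invlim_proj k x != 1%g.
    apply: contrapT => h; apply: x1; apply: invlim_proj_inj => k.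
    by apply/eqP/negPn/negP => xk; apply: h; exists k.
  have cst_near : \forall N \near \oo, q (F x) = H N x.
    exists k => // N /= kN; rewrite /H !indicE memNset// mem_set//=.
    rewrite mulr0 add0r mulr1 /F /F_ (gtilde_partial_stationary xk kN).
    suff -> : gtilde g x = gtilde_partial g x k by [].
    have ev : \forall l \near \oo,
        gtilde_partial g x l = gtilde_partial g x k :> R[i]^o.
      by exists k => // l /= kl; exact: gtilde_partial_stationary.
    exact: (cvg_lim (@norm_hausdorff _ R[i]^o) (cvg_near_cst _ ev)).
  apply: cvg_near_cst; apply: filterS cst_near => N.
  by move=> ->.
have aeF : {ae nu, forall x, (F_ ^~ x : nat -> R[i]^o) @ \oo --> (F x : R[i]^o)}.
  have FF : Filter (nbhs (almost_everywhere nu)).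
    exact: (@ae_filter_ringOfSetsType _ (borel S) R nu).
  have := gtilde_partial_ae; apply: filterS => x gx; apply: cvgM; last exact: cvg_cst.
  exact: gx.
have [] := @complex_dominated_convergence _ _ _ nu F_ F gtilde_bound.
- by move=> N; case: (step N).
- by move=> N; case: (step N).
- by apply: mF; [left|move=> N; case: (step N)].
- by apply: mF; [right|move=> N; case: (step N)].
- exact: aeF.
- exact: gtilde_bound_integrable.
- move=> N x; apply: le_trans (cnorm_gtilde_partial N x).
  rewrite lee_fin /F_ cnormM (@cnorm_unity_root _ m (psi x ^+ i))//.
    by rewrite mulr1; exact: cnorm_sum.
  by rewrite exprAC (mu_charX psi_char) expr1n.
- move=> intF cvF; split => //.
  by under eq_fun do rewrite -intE.
Qed.

End LocalFactor.

(** * The sum over all characters *)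

Theorem corollary4p1 (R : realType) (G A : invsystem dvd_pos)
  (G_surj : surjective_system G) (A_surj : surjective_system A)
  (r : sysmorphism G A) (r_inj : forall n : posint, injective (r n))
  (m : nat) (m_gt0 : (0 < m)%N)
  (chi : invlim A -> R[i]) (chi_char : is_mu_character m chi)
  (chi_exact : exact_sequence m (lim_map r) chi)
  (g : nat -> R[i]) (g_mult : multiplicative_fun g)
  (g_sum : (\sum_(0 <= n <oo)
      (complex.Re `|g n.+1| / #|G (possucc n)|%:R)%:E < +oo)%E)
  (h : prime_decomposition A)
  (chip : forall p : primeint, invlim (primary A p) -> R[i])
  (chip_char : forall p, is_mu_character m (chip p))
  (chip_fin : finite_set [set p | exists x, chip p x != 1])
  (chi_prod : forall alpha : invlim A,
      chi alpha =
      \big[*%R/1]_(p \in [set: primeint]) chip p (component h p alpha))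
  (nu : forall p : primeint, probability (borel (primary A p)) R)
  (nu_haar : forall p, is_haar (nu p)) :
  (forall p : primeint,
     {ae nu p, forall x, cvgn (gtilde_partial g x)} /\
     complex_integrable (nu p) (@gtilde R A g p)) /\
  exists P : 'I_m -> R[i],
    (forall i : 'I_m,
       ((fun N : nat =>
           \big[*%R/1]_(p \in [set p : primeint | (val p < N)%N])
             complex_integral (nu p)
               (fun x => @gtilde R A g p x * chip p x ^+ i)) : nat -> R[i]^o)
       @ \oo --> (P i : R[i]^o)) /\
    ((fun N : nat => \sum_(0 <= n < N) g n.+1 / #|G (possucc n)|%:R)
       : nat -> R[i]^o) @ \oo --> (\sum_(i < m) P i : R[i]^o).
Proof.
pose lev n := possucc n.-1.
pose u n : R := cnorm (g n) / #|G (lev n)|%:R.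
have u0 n : 0 <= u n by rewrite divr_ge0// cnorm_ge0.
have [C uC] : exists C, forall N, \sum_(0 <= n < N) u n.+1 <= C.
  set U := (X in (X < _)%E) in g_sum.
  have U0 : (0 <= U)%E by apply: nneseries_ge0 => n _ _; rewrite lee_fin; exact: u0 n.+1.
  exists (fine U) => N; rewrite -lee_fin fineK ?ge0_fin_numE// -sumEFin.
  by apply: nneseries_lim_ge => n *; rewrite lee_fin; exact: (u0 n.+1).
have cG_gt0 n : (0 < #|G n|)%N by apply/card_gt0P; exists 1%g.
have GA n : (#|G n| <= #|A n|)%N by exact: leq_card (r_inj n).
have VGA n : (#|A n|%:R^-1 : R) <= #|G n|%:R^-1.
  by rewrite lef_pV2 ?posrE ?ltr0n ?ler_nat// (leq_trans _ (GA n)).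
have lev_ppow (p : primeint) k : lev (val p ^ k)%N = ppow p k.
  exact: (possuccK (ppow p k)).
have summable p N :
    \sum_(0 <= k < N) cnorm (g (val p ^ k)%N) / #|A (ppow p k)|%:R <= C.
  apply: (@le_trans _ _ (\sum_(0 <= k < N) u (val p ^ k)%N)).
    by apply: ler_sum => k _; rewrite /u lev_ppow ler_wpM2l// cnorm_ge0.
  rewrite -(big_map (fun k => (val p ^ k)%N) xpredT u).
  apply: (sum_uniq_tail u0 uC).
    rewrite map_inj_uniq ?iota_uniq//.
    exact: expnI (prime_gt1 (valP p)).
  by move=> _ /mapP[k _ ->]; exact: ppow_gt0.
have local p i := local_factor A_surj (nu_haar p) m_gt0 (chip_char p)
  (summable p) i.
split=> [p|].
  split; first exact: (gtilde_partial_ae A_surj (nu_haar p) (summable p)).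
  have [intg _] := local p 0%N.
  rewrite (_ : @gtilde R A g p = fun x => gtilde g x * chip p x ^+ 0)//.
  by apply/funext => x; rewrite expr0 mulr1.
(* A bound for the primes at which the local character is nontrivial. *)
have [s sE] := (finite_seqP _).1 chip_fin.
pose N0 := (\max_(p <- s) val p).+1.
have chip1 N p x : (N0 <= N)%N -> p \notin primes_below N -> chip p x = 1.
  move=> N0N; rewrite mem_primes_below -leqNgt => Np.
  apply/eqP/negPn/negP => px.
  have ps : [set` s] p by rewrite -sE; exists x.
  have := @leq_bigmax_seq _ s xpredT (fun q : primeint => val q) p ps isT.
  by rewrite leqNgt (leq_trans N0N Np).
(* [w i n] is the integral of [chi ^ i] over the kernel of [A -> A(n)]. *)
pose w i n : R[i] :=
  if trivial_on_kernel chi (lev n) i then (#|A (lev n)|%:R)^-1 else 0.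
pose b i p k : R[i] := g (val p ^ k)%N *
  (if trivial_on_local_kernel chip i p k then (#|A (ppow p k)|%:R)^-1 else 0).
have euler i := @euler_product R (fun n => g n * w i n) u (b i)
  (fun p => complex_integral (nu p) (fun x => gtilde g x * chip p x ^+ i))
  C N0 _ u0 uC (fun p => (local p i).2).
have {euler} /choice [P PP] : forall i : 'I_m, exists L : R[i],
    ((fun N => \sum_(0 <= n < N) g n.+1 * w i n.+1) : nat -> R[i]^o) @ \oo
      --> (L : R[i]^o) /\
    ((fun N => \prod_(p <- primes_below N)
        complex_integral (nu p) (fun x => gtilde g x * chip p x ^+ i))
      : nat -> R[i]^o) @ \oo --> (L : R[i]^o).
  move=> i; apply: euler => [n n0|N n N0N n0 nN].
    rewrite cnormM ler_wpM2l ?cnorm_ge0// /w; case: ifP => _; last first.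
      by rewrite cnorm0 invr_ge0.
    have VC k : (k%:R^-1 : R[i]) = (k%:R^-1)%:C%C by rewrite fmorphV rmorph_nat.
    by rewrite VC cnorm_real ?invr_ge0.
  have levn : val (lev n) = n by rewrite /= prednK.
  rewrite big_split/= -(multiplicative_prod g_mult (primes_below_uniq N) n0 nN).
  rewrite prod_if_all /w; congr (_ * _).
  have -> : trivial_on_kernel chi (lev n) i = all (fun p : primeint =>
      trivial_on_local_kernel chip i p (logn (val p) n)) (primes_below N).
    apply/idP/allP => [/(trivial_on_kernel_local m_gt0 chip_char chi_prod) t p _|t].
      by have := t p; rewrite levn.
    apply/(trivial_on_kernel_local m_gt0 chip_char chi_prod) => p; rewrite levn.
    have [/t //|pN] := boolP (p \in primes_below N).
    by apply/asboolP => x _; rewrite (chip1 N)// expr1n.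
  case: all => //.
  rewrite (card_level_prod h (primes_below_uniq N)) ?levn//.
  by rewrite natr_prod -prodfV.
exists P; split=> [i|].
  by under eq_fun do rewrite fsbig_primes_below; exact: (PP i).2.
(* The number of nonzero [w i n] is the index of [G(n)] in [A(n)]. *)
have GE n : g n.+1 / #|G (possucc n)|%:R = \sum_(i < m) g n.+1 * w i n.+1.
  pose t := #|[pred i : 'I_m | trivial_on_kernel chi (possucc n) i]|.
  have AE : #|A (possucc n)| = (t * #|G (possucc n)|)%N.
    exact: (card_level_index G_surj A_surj r_inj m_gt0 chi_char chi_exact).
  have t0 : (t%:R : R[i]) != 0.
    have := leq_trans (cG_gt0 (possucc n)) (GA (possucc n)).
    by rewrite pnatr_eq0 AE muln_gt0 lt0n => /andP[].
  rewrite -mulr_sumr; congr (_ * _); rewrite /w -big_mkcond/= sumr_const.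
  transitivity ((#|A (possucc n)|%:R : R[i])^-1 *+ t).
    by rewrite -[RHS]mulr_natr AE natrM invfM mulrAC mulVf// mul1r.
  by congr (_ *+ _); exact: eq_card.
under eq_fun => N.
  under eq_bigr => n _ do rewrite GE.
  rewrite exchange_big/=.
  over.
apply: (@cvg_big R[i]^o) => [|i _]; first exact: add_continuous.
exact: (PP i).1.
Qed.
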